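(* Let $n,m,l\in\mathbb{N}$, let $\Phi:\mathbb{M}_n\to\mathbb{M}_l$ and $\Psi:\mathbb{M}_m\to\mathbb{M}_l$ be strictly positive linear maps, let $f$ be a non-decreasing function on $(0,\infty)$ and $1<p\le2$, and assume that $x\mapsto f(x^{p-1})$ is convex on $(0,\infty)$. Let $q\in[-1,0]$. (1) If $\Phi$ is completely positive, then $(A,B)\in\mathbb{P}_n\times\mathbb{P}_m\mapsto\mathrm{Tr}\, f\bigl(\Phi(A^p)^{1/2}\Psi(B^q)\Phi(A^p)^{1/2}\bigr)$ is jointly convex. (2) If $n=l$ and $\Phi=\mathrm{id}$, then $(A,B)\in\mathbb{P}_n\times\mathbb{P}_m\mapsto\mathrm{Tr}\, f\bigl((\Phi(A^{-p})^{1/2}\Psi(B^{-q})\Phi(A^{-p})^{1/2})^{-1}\bigr)$ is jointly convex.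
   Context: $\mathbb{M}_n$: $n\times n$ complex matrices; $\mathbb{P}_n$: positive definite ones; $\mathrm{Tr}$: usual trace. A linear map is strictly positive if it maps positive definite matrices to positive definite matrices. *)

(* Defs.v *)
(* complex matrices over R[i] (R : realType), spectral.v,
   real powers via mathcomp-analysis powR. *)
From HB Require Import structures.
From mathcomp Require Import all_boot all_order all_algebra.
From mathcomp Require Import sesquilinear spectral.
From mathcomp Require Import complex.
From mathcomp Require Import reals exp.
Set Implicit Arguments. Unset Strict Implicit. Unset Printing Implicit Defensive.
Import Order.TTheory GRing.Theory Num.Theory.
Local Open Scope ring_scope.
Local Open Scope sesquilinear_scope.

Section Defs.
Variable R : realType.
Local Notation C := (R[i]).

(* embedding of reals into complex numbers *)
Definition rC (t : R) : C := Complex t 0.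

(* positive definite / positive semidefinite complex matrices *)
Definition posdef n (A : 'M[C]_n) : Prop :=
  A \is hermsymmx /\ forall v : 'rV[C]_n, v != 0 -> 0 < (v *m A *m v ^t*) 0 0.
Definition possemidef n (A : 'M[C]_n) : Prop :=
  A \is hermsymmx /\ forall v : 'rV[C]_n, 0 <= (v *m A *m v ^t*) 0 0.

(* functional calculus f(A) for a Hermitian matrix A, via the spectral
   decomposition A = P^-1 diag(d) P (P unitary, d real) of spectral.v *)
Definition mxfun (f : R -> R) n (A : 'M[C]_n) : 'M[C]_n :=
  invmx (spectralmx A) *m
    diag_mx (map_mx (fun z : C => rC (f (complex.Re z))) (spectral_diag A)) *m
    spectralmx A.

(* real power A^p (for positive definite A) *)
Definition mxpow n (A : 'M[C]_n) (p : R) : 'M[C]_n := mxfun (fun x => powR x p) A.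

(* Tr f(X), a real number for Hermitian X *)
Definition trf (f : R -> R) n (X : 'M[C]_n) : R := complex.Re (\tr (mxfun f X)).

(* strictly positive linear map: P_n -> P_l *)
Definition strictly_positive n l (Phi : 'M[C]_n -> 'M[C]_l) : Prop :=
  forall A, posdef A -> posdef (Phi A).

(* completely positive: id_{M_k} (x) Phi is positive for every k *)
Definition completely_positive n l (Phi : 'M[C]_n -> 'M[C]_l) : Prop :=
  forall k (X : 'I_k -> 'I_k -> 'M[C]_n),
    possemidef (\mxblock_(i < k, j < k) X i j) ->
    possemidef (\mxblock_(i < k, j < k) Phi (X i j)).

(* joint convexity on P_n x P_m of a real-valued function *)
Definition jointly_convex n m (F : 'M[C]_n -> 'M[C]_m -> R) : Prop :=
  forall A1 A2 B1 B2, posdef A1 -> posdef A2 -> posdef B1 -> posdef B2 ->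
  forall t : R, 0 <= t <= 1 ->
    F (rC t *: A1 + rC (1 - t) *: A2) (rC t *: B1 + rC (1 - t) *: B2)
      <= t * F A1 B1 + (1 - t) * F A2 B2.

(* f non-decreasing on (0, oo) *)
Definition nondecreasing_pos (f : R -> R) : Prop :=
  forall x y, 0 < x -> x <= y -> f x <= f y.

(* g convex on (0, oo) *)
Definition convex_pos (g : R -> R) : Prop :=
  forall x y t, 0 < x -> 0 < y -> 0 <= t <= 1 ->
    g (t * x + (1 - t) * y) <= t * g x + (1 - t) * g y.

End Defs.

(* Main.v *)
(* Put [al = p - 1], [g u = f (u^al)] and [h y = sup_u (u^al y - g u)].  Writing
   [Phi X = K^* (1 (x) X) K] and [A' = 1 (x) A], cyclicity replaces the matrix of
   the theorem by [X = A'^(p/2) M A'^(p/2)] with [M = K Psi(B^q) K^*].  For every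
   fixed [W >= 0], Fenchel's inequality for traces gives
     Tr f(X) >= Tr (A' M A' W) - Tr h(W^(1/2) A'^(1-al) W^(1/2)),
   with equality for a suitable [W].  The first term is jointly convex in [(A, B)]
   because [(x, B) |-> x^* Psi(B^q) x] is.  The second is concave in [A]: it is the
   supremum over [U > 0] of Tr (W^(1/2) A'^(1-al) W^(1/2) U^al) - Tr g(U), which is
   jointly concave in [(A, U)] by Lieb's theorem.  Lieb's theorem is obtained from
   the maximality of the geometric mean at dyadic exponents, and by continuity at
   all exponents.  In part (2), [M] is the inverse of [Psi(B^(-q))]. *)
Require Import Defs.
From HB Require Import structures.
From mathcomp Require Import all_boot all_order all_algebra.
From mathcomp Require Import sesquilinear spectral.
From mathcomp Require Import complex.
From mathcomp Require Import reals exp.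
From mathcomp Require Import ring lra.
From mathcomp Require Import boolp classical_sets topology normedtype sequences.
From mathcomp Require mxtens.
Set Implicit Arguments. Unset Strict Implicit. Unset Printing Implicit Defensive.
Import Order.TTheory GRing.Theory Num.Theory.
Import numFieldTopology.Exports numFieldNormedType.Exports.
Local Open Scope ring_scope.
Local Open Scope sesquilinear_scope.

(** * Real numbers inside the complex numbers *)

Section Complexes.
Variable R : realType.
Local Notation C := (R[i]).

(** Two features of [f] shape the argument. It is controlled on the open half-line only, while the
    matrix obtained by cyclicity is singular in general; so [f] gets at [0] the infimum of its
    values, and in part (1) the change of dimension contributes a constant that cancels in the
    convexity inequality. Moreover [h] can be infinite, for instance when [f] is constant; a term
    [e * u^2] is therefore added to [g], and [e] tends to [0] at the end. Even then maximisers in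
    [h] are taken only up to an error.

    The powers fit together as follows. With [P = A^(p/2)] and [Q = A^(1-p/2)] one has [P Q = A], so
    pairing [P M P] with [Q W Q] gives the trace of [A M A W], while [Q^2 = A^r] with [r = 2 - p] in
    [[0, 1)]. Since [al = 1 - r], the exponents of [A] and [U] in Lieb's trace sum to [1]. The
    matrix [W] is chosen at the combined point, where equality is needed, and the same [W] is used
    in the lower bounds at the two endpoints. *)

Lemma rC_le (x y : R) : (rC x <= rC y) = (x <= y).
Proof. exact: lecR. Qed.
Lemma rC_lt (x y : R) : (rC x < rC y) = (x < y).
Proof. exact: ltcR. Qed.
Lemma rC_conj (x : R) : (rC x)^* = rC x.
Proof. by apply/eqP; rewrite eq_complex /= oppr0 !eqxx. Qed.
Lemma rC_inj : injective (@rC R).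
Proof. by move=> x y []. Qed.
Lemma rCD (x y : R) : rC (x + y) = rC x + rC y.
Proof. exact: (rmorphD (real_complex R)). Qed.
Lemma rCM (x y : R) : rC (x * y) = rC x * rC y.
Proof. exact: (rmorphM (real_complex R)). Qed.
Lemma rC_sum (I : Type) (s : seq I) (P : pred I) (F : I -> R) :
  rC (\sum_(i <- s | P i) F i) = \sum_(i <- s | P i) rC (F i).
Proof. exact: (rmorph_sum (real_complex R)). Qed.
Lemma rC_ge0 (z : C) : 0 <= z -> exists2 x : R, 0 <= x & z = rC x.
Proof. by case: z => a b; rewrite lecE /= => /andP[/eqP -> a0]; exists a. Qed.
Lemma rC_real (z : C) : z \is Num.real -> z = rC (complex.Re z).
Proof.
rewrite realE => /orP[/rC_ge0[x _ ->] // |]; rewrite -oppr_ge0 => /rC_ge0[x _ E].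
by rewrite -[z]opprK E -(rmorphN (real_complex R)).
Qed.
End Complexes.

(** * Functional calculus of Hermitian matrices, cyclicity and Klein's inequality *)

Section Calculus.
Variable R : realType.
Local Notation C := (R[i]).

Definition adjmx m n (A : 'M[C]_(m, n)) : 'M[C]_(n, m) := A^t*.

Local Notation "A ^H" := (adjmx A) (at level 2, format "A ^H").

Lemma adjmxE m n (A : 'M[C]_(m, n)) i j : A^H i j = (A j i)^*.
Proof. by rewrite mxE mxE. Qed.
Lemma adjmxK m n (A : 'M[C]_(m, n)) : A^H^H = A.
Proof. by apply/matrixP => i j; rewrite !adjmxE conjCK. Qed.
Lemma adjmxM m n p (A : 'M[C]_(m, n)) (B : 'M[C]_(n, p)) :
  (A *m B)^H = B^H *m A^H.
Proof.
apply/matrixP => i j; rewrite adjmxE !mxE rmorph_sum; apply: eq_bigr => k _.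
by rewrite !adjmxE rmorphM mulrC.
Qed.
Lemma adjmxD m n (A B : 'M[C]_(m, n)) : (A + B)^H = A^H + B^H.
Proof. by apply/matrixP => i j; rewrite !(mxE, adjmxE) rmorphD. Qed.
Lemma adjmxZ m n (a : R) (A : 'M[C]_(m, n)) : (rC a *: A)^H = rC a *: A^H.
Proof.
by apply/matrixP => i j; rewrite !mxE rmorphM; congr (_ * _); apply: rC_conj.
Qed.
Lemma adjmx1 n : (1%:M : 'M[C]_n)^H = 1%:M.
Proof. by apply/matrixP => i j; rewrite adjmxE !mxE conjC_nat eq_sym. Qed.

Definition herm n (A : 'M[C]_n) := A^H = A.

Lemma hermP n (A : 'M[C]_n) : (A \is hermsymmx) <-> herm A.
Proof.
by rewrite is_hermitianmxE expr0 scale1r; split=> [/eqP /esym | /esym /eqP].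
Qed.
Lemma herm_gram m n (A : 'M[C]_(m, n)) : herm (A *m A^H).
Proof. by rewrite /herm adjmxM adjmxK. Qed.
Lemma herm_congr m n (A : 'M[C]_(m, n)) (B : 'M[C]_n) : herm B -> herm (A *m B *m A^H).
Proof. by move=> hB; rewrite /herm !adjmxM adjmxK hB mulmxA. Qed.

Definition rdiag n (e : 'I_n -> R) : 'M[C]_n := diag_mx (\row_i rC (e i)).

Lemma rdiagE n (e : 'I_n -> R) i j : rdiag e i j = rC (e i) *+ (i == j).
Proof. by rewrite !mxE; case: eqP => // ->. Qed.
Lemma rdiag_adj n (e : 'I_n -> R) : herm (rdiag e).
Proof.
apply/matrixP => i j; rewrite adjmxE !rdiagE eq_sym.
by case: eqP => [->|_]; rewrite ?mulr1n ?rC_conj // mulr0n conjC0.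
Qed.
Lemma rdiagM n (e f : 'I_n -> R) : rdiag e *m rdiag f = rdiag (fun i => e i * f i).
Proof.
rewrite /rdiag mulmx_diag; congr diag_mx; apply/rowP => i.
by rewrite !mxE rCM.
Qed.
Lemma mul_rdiagl m n (e : 'I_m -> R) (A : 'M[C]_(m, n)) i j :
  (rdiag e *m A) i j = rC (e i) * A i j.
Proof. by rewrite mul_diag_mx !mxE. Qed.
Lemma mul_rdiagr m n (e : 'I_n -> R) (A : 'M[C]_(m, n)) i j :
  (A *m rdiag e) i j = A i j * rC (e j).
Proof. by rewrite mul_mx_diag !mxE. Qed.
Lemma eq_rdiag n (e f : 'I_n -> R) : e =1 f -> rdiag e = rdiag f.
Proof. by move=> ef; apply/matrixP => i j; rewrite !rdiagE ef. Qed.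
Lemma rdiag1 n : rdiag (fun _ : 'I_n => 1) = 1%:M.
Proof. by apply/matrixP => i j; rewrite rdiagE !mxE. Qed.

(** Any unitary diagonalisation is allowed, not only the one selected by [spectralmx]: tensor
    products and transposes come with their own. *)
Record diagonalizes n (P : 'M[C]_n) (e : 'I_n -> R) (A : 'M[C]_n) : Prop :=
  Diagonalizes { diag_unitr : P *m P^H = 1%:M;
                 diag_unitl : P^H *m P = 1%:M;
                 diag_eq : A = P^H *m rdiag e *m P }.

Lemma spectral_unitr n (A : 'M[C]_n) : spectralmx A *m (spectralmx A)^H = 1%:M.
Proof. by have /unitarymxP := spectral_unitarymx A. Qed.
Lemma spectral_unitl n (A : 'M[C]_n) : (spectralmx A)^H *m spectralmx A = 1%:M.
Proof. by apply: mulmx1C; exact: spectral_unitr. Qed.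
Lemma spectral_inv n (A : 'M[C]_n) : invmx (spectralmx A) = (spectralmx A)^H.
Proof. exact: (invmx_unitary (spectral_unitarymx A)). Qed.

Lemma mxfun_spectral n (A : 'M[C]_n) (f : R -> R) :
  mxfun f A = (spectralmx A)^H *m
    rdiag (fun i => f (complex.Re (spectral_diag A 0 i))) *m spectralmx A.
Proof.
rewrite /mxfun spectral_inv; congr (_ *m diag_mx _ *m _).
by apply/rowP => i; rewrite !mxE.
Qed.

Lemma herm_diag n (A : 'M[C]_n) : herm A ->
  diagonalizes (spectralmx A) (fun i => complex.Re (spectral_diag A 0 i)) A.
Proof.
move=> /hermP hA; split; [exact: spectral_unitr | exact: spectral_unitl |].
have /orthomx_spectralP {1}-> := hermitian_normalmx hA.
rewrite spectral_inv; congr (_ *m _ *m _).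
apply/matrixP => i j; rewrite rdiagE mxE; congr (_ *+ _).
by apply: rC_real; have /mxOverP := hermitian_spectral_diag_real hA.
Qed.

Lemma diag_herm n P e (A : 'M[C]_n) : diagonalizes P e A -> herm A.
Proof. by case=> _ _ ->; rewrite /herm !adjmxM rdiag_adj adjmxK mulmxA. Qed.

(** In the eigenbases [T] becomes [O] with [O i j * e j = d i * O i j], so a nonzero entry forces
    [e j = d i] and [f] can be applied to both. The case [T = 1] shows that the functional calculus
    does not depend on the diagonalisation. *)
Lemma diag_intertwine m n P e Q d (A : 'M[C]_n) (B : 'M[C]_m) (T : 'M[C]_(m, n))
    (f : R -> R) :
  diagonalizes P e A -> diagonalizes Q d B -> T *m A = B *m T ->
  T *m (P^H *m rdiag (f \o e) *m P) = Q^H *m rdiag (f \o d) *m Q *m T.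
Proof.
move=> [uP uP' ->] [uQ uQ' ->] E; pose O := Q *m T *m P^H.
have {}E : O *m rdiag e = rdiag d *m O.
  move/(congr1 (fun X => Q *m X *m P^H)): E.
  by rewrite /O !mulmxA uQ mul1mx -!mulmxA uP mulmx1.
have Ef : O *m rdiag (f \o e) = rdiag (f \o d) *m O.
  move: (O) E => {}O E; apply/matrixP => i j; move/matrixP/(_ i j): E.
  rewrite !mul_rdiagl !mul_rdiagr => E.
  have [-> | O0] := eqVneq (O i j) 0; first by rewrite mul0r mulr0.
  rewrite mulrC; congr (_ * _); rewrite /=; congr (rC (f _)); apply: rC_inj.
  by apply: (mulIf O0); rewrite mulrC E.
move/(congr1 (fun X => Q^H *m X *m P)): Ef.
rewrite /O !mulmxA uQ' mul1mx => ->.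
by rewrite -!mulmxA uP' mulmx1.
Qed.

Lemma mxfun_diag n P e (A : 'M[C]_n) (f : R -> R) :
  diagonalizes P e A -> mxfun f A = P^H *m rdiag (f \o e) *m P.
Proof.
move=> dA; rewrite mxfun_spectral.
have := diag_intertwine (T := 1%:M) f (herm_diag (diag_herm dA)) dA.
by rewrite mul1mx [A *m _]mulmx1 => /(_ erefl); rewrite mul1mx mulmx1 => <-.
Qed.

Lemma diag_mxfun n P e (A : 'M[C]_n) (f : R -> R) :
  diagonalizes P e A -> diagonalizes P (f \o e) (mxfun f A).
Proof. by move=> dA; have [uP uP' _] := dA; split=> //; exact: mxfun_diag. Qed.

Lemma mxfun_intertwine m n (A : 'M[C]_n) (B : 'M[C]_m) (T : 'M[C]_(m, n))
    (f : R -> R) : herm A -> herm B -> T *m A = B *m T ->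
  T *m mxfun f A = mxfun f B *m T.
Proof.
move=> /herm_diag dA /herm_diag dB E.
by rewrite (mxfun_diag _ dA) (mxfun_diag _ dB) (diag_intertwine _ dA dB).
Qed.

Lemma mxfun_herm n (A : 'M[C]_n) f : herm A -> herm (mxfun f A).
Proof. by move=> /herm_diag /(diag_mxfun f) /diag_herm. Qed.

Lemma mxfunM n (A : 'M[C]_n) f g : herm A ->
  mxfun f A *m mxfun g A = mxfun (fun x => f x * g x) A.
Proof.
move=> /herm_diag dA; rewrite !(mxfun_diag _ dA); case: dA => uP _ _.
by rewrite !mulmxA -(mulmxA _ _ _^H) uP mulmx1 -(mulmxA _ (rdiag _) (rdiag _)) rdiagM.
Qed.

Lemma mxfun_comp n (A : 'M[C]_n) f g : herm A ->
  mxfun g (mxfun f A) = mxfun (g \o f) A.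
Proof.
move=> /herm_diag dA.
by rewrite (mxfun_diag _ (diag_mxfun f dA)) (mxfun_diag _ dA).
Qed.

Lemma mxfun_id n (A : 'M[C]_n) : herm A -> mxfun id A = A.
Proof. by move=> /herm_diag dA; rewrite (mxfun_diag _ dA) [RHS](diag_eq dA). Qed.

Lemma mxfun_1 n (A : 'M[C]_n) f : herm A -> (forall x, f x = 1) ->
  mxfun f A = 1%:M.
Proof.
move=> /herm_diag dA f1; rewrite (mxfun_diag _ dA) (@eq_rdiag _ _ (fun=> 1)) => [|i //=].
by rewrite rdiag1 mulmx1 (diag_unitl dA).
Qed.

Lemma trf_diag n P e (A : 'M[C]_n) f : diagonalizes P e A ->
  trf f A = \sum_i f (e i).
Proof.
move=> dA; rewrite /trf (mxfun_diag _ dA) mxtrace_mulC mulmxA.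
rewrite (diag_unitr dA) mul1mx mxtrace_diag.
under eq_bigr do rewrite mxE.
by rewrite -rC_sum.
Qed.

Lemma trf_rC n (A : 'M[C]_n) f : herm A -> \tr (mxfun f A) = rC (trf f A).
Proof.
move=> /herm_diag dA; rewrite (trf_diag _ dA) (mxfun_diag _ dA) mxtrace_mulC mulmxA.
rewrite (diag_unitr dA) mul1mx mxtrace_diag.
under eq_bigr do rewrite mxE.
by rewrite -rC_sum.
Qed.

Lemma trf_mxfun n (A : 'M[C]_n) f g : herm A ->
  trf g (mxfun f A) = trf (g \o f) A.
Proof. by move=> hA; rewrite /trf mxfun_comp. Qed.

Lemma eq_trf n (A : 'M[C]_n) f g : f =1 g -> trf f A = trf g A.
Proof. by move=> /boolp.funext ->. Qed.
Lemma trfD n (A : 'M[C]_n) f g : herm A ->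
  trf (fun x => f x + g x) A = trf f A + trf g A.
Proof. by move=> /herm_diag dA; rewrite !(trf_diag _ dA) big_split. Qed.
Lemma trfZ n (A : 'M[C]_n) f a : herm A ->
  trf (fun x => a * f x) A = a * trf f A.
Proof. by move=> /herm_diag dA; rewrite !(trf_diag _ dA) mulr_sumr. Qed.
Lemma trf_cst n (A : 'M[C]_n) a : herm A ->
  trf (fun=> a) A = a *+ n.
Proof. by move=> /herm_diag dA; rewrite !(trf_diag _ dA) sumr_const card_ord. Qed.

(* Writing [f x = f 0 + x * k x], the trace of [x * k x] is handled by cyclicity
   because the adjoint of [T] intertwines both Gram matrices. *)
Lemma trf_gram m n (T : 'M[C]_(m, n)) f :
  trf f (T *m T^H) = trf f (T^H *m T) + (f 0 *+ m - f 0 *+ n).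
Proof.
have h1 := herm_gram T.
have h2 : herm (T^H *m T) by have := herm_gram T^H; rewrite adjmxK.
pose k x := (f x - f 0) / x.
have kE q (A : 'M[C]_q) : herm A ->
    trf f A = trf (fun x => x * k x) A + f 0 *+ q.
  move=> hA; have <- := trf_cst (f 0) hA.
  have <- := trfD (fun x => x * k x) (fun=> f 0) hA.
  apply: eq_trf => x; rewrite /k.
  have [->|x0] := eqVneq x 0; first by rewrite mul0r add0r.
  by rewrite mulrC divfK // subrK.
rewrite !kE // -!addrA; congr (_ + _); last by rewrite addrCA subrr addr0.
apply: rC_inj; rewrite -!trf_rC // -!(@mxfunM _ _ id k) // !mxfun_id //.
rewrite -mulmxA [LHS]mxtrace_mulC.
rewrite (_ : T^H *m mxfun k _ = mxfun k (T^H *m T) *m T^H); last first.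
  by apply: mxfun_intertwine => //; rewrite mulmxA.
by rewrite [RHS]mxtrace_mulC mulmxA.
Qed.

(* Diagonalising [X = P^* diag(x) P] and [Y = Q^* diag(y) Q], the weights are
   the squared moduli of the entries of the unitary [P Q^*]. *)
Lemma klein n (X Y : 'M[C]_n) (S T : R -> Prop) (a b e d : R -> R) P Q x y :
  diagonalizes P x X -> diagonalizes Q y Y ->
  (forall i, S (x i)) -> (forall j, T (y j)) ->
  (forall u v, S u -> T v -> 0 <= a u + b v + e u * d v) ->
  0 <= trf a X + trf b Y + complex.Re (\tr (mxfun e X *m mxfun d Y)).
Proof.
move=> dX dY Sx Ty H; rewrite (trf_diag _ dX) (trf_diag _ dY).
rewrite (mxfun_diag _ dX) (mxfun_diag _ dY).
case: dX => uP uP' _; case: dY => uQ uQ' _.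
pose O := P *m Q^H.
have uO : O *m O^H = 1%:M by rewrite adjmxM adjmxK mulmxA -(mulmxA P) uQ' mulmx1.
have uO' : O^H *m O = 1%:M by exact: mulmx1C.
pose w i j : R := complex.Re (O i j * (O i j)^*).
have wE i j : rC (w i j) = O i j * (O i j)^*.
  by rewrite /w -rC_real // ger0_real // mul_conjC_ge0.
have w0 i j : 0 <= w i j by rewrite -rC_le wE mul_conjC_ge0.
have w1 i : \sum_j w i j = 1.
  apply: rC_inj; rewrite rC_sum (_ : rC 1 = (O *m O^H) i i); last first.
    by rewrite uO mxE eqxx.
  rewrite mxE; apply: eq_bigr => j _.
  by rewrite wE adjmxE.
have w2 j : \sum_i w i j = 1.
  apply: rC_inj; rewrite rC_sum (_ : rC 1 = (O^H *m O) j j); last first.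
    by rewrite uO' mxE eqxx.
  rewrite mxE; apply: eq_bigr => i _.
  by rewrite wE adjmxE mulrC.
have -> : \tr (P^H *m rdiag (e \o x) *m P *m (Q^H *m rdiag (d \o y) *m Q)) =
    rC (\sum_i \sum_j w i j * (e (x i) * d (y j))).
  have -> : P^H *m rdiag (e \o x) *m P *m (Q^H *m rdiag (d \o y) *m Q) =
     P^H *m (rdiag (e \o x) *m O *m rdiag (d \o y) *m Q).
    by rewrite /O !mulmxA.
  rewrite mxtrace_mulC.
  have -> : rdiag (e \o x) *m O *m rdiag (d \o y) *m Q *m P^H =
      rdiag (e \o x) *m O *m rdiag (d \o y) *m O^H.
    by rewrite /O adjmxM adjmxK !mulmxA.
  rewrite rC_sum; apply: eq_bigr => i _; rewrite mxE rC_sum.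
  apply: eq_bigr => j _; rewrite mul_rdiagr mul_rdiagl adjmxE.
  by rewrite !rCM wE /= [rC _ * _]mulrC -!mulrA; congr (_ * _); rewrite mulrA mulrC.
have -> : \sum_i a (x i) = \sum_i \sum_j w i j * a (x i).
  by apply: eq_bigr => i _; rewrite -mulr_suml w1 mul1r.
have -> : \sum_i b (y i) = \sum_i \sum_j w i j * b (y j).
  by rewrite exchange_big; apply: eq_bigr => i _; rewrite -mulr_suml w2 mul1r.
rewrite -!big_split; apply: sumr_ge0 => i _; rewrite -!big_split.
by apply: sumr_ge0 => j _; rewrite /= -!mulrDr mulr_ge0 // H.
Qed.

End Calculus.

Local Notation "A ^H" := (adjmx A) (at level 2, format "A ^H").
Local Notation "A *t B" := (mxtens.tensmx A B) (at level 40, left associativity).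

(** * Positive matrices, their quadratic forms and the Loewner order *)

Section Positivity.
Variable R : realType.
Local Notation C := (R[i]).

Definition qform n (v : 'rV[C]_n) (A : 'M[C]_n) : C := (v *m A *m v^H) 0 0.

Lemma psdP n (A : 'M[C]_n) :
  possemidef A <-> herm A /\ forall v, 0 <= qform v A.
Proof. by split=> -[/hermP hA H]. Qed.
Lemma posdefP n (A : 'M[C]_n) :
  posdef A <-> herm A /\ forall v, v != 0 -> 0 < qform v A.
Proof. by split=> -[/hermP hA H]. Qed.
Lemma psd_herm n (A : 'M[C]_n) : possemidef A -> herm A.
Proof. by case/psdP. Qed.
Lemma posdef_herm n (A : 'M[C]_n) : posdef A -> herm A.
Proof. by case/posdefP. Qed.
Lemma psd_ge0 n (A : 'M[C]_n) v : possemidef A -> 0 <= qform v A.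
Proof. by case/psdP. Qed.
Lemma posdef_psd n (A : 'M[C]_n) : posdef A -> possemidef A.
Proof.
case/posdefP => hA H; apply/psdP; split=> // v.
have [->|v0] := eqVneq v 0; last exact/ltW/H.
by rewrite /qform !mul0mx mxE.
Qed.

Lemma qformD n (v : 'rV[C]_n) A B : qform v (A + B) = qform v A + qform v B.
Proof. by rewrite /qform mulmxDr mulmxDl mxE. Qed.
Lemma qformZ n (v : 'rV[C]_n) (a : C) A : qform v (a *: A) = a * qform v A.
Proof. by rewrite /qform -scalemxAr -scalemxAl mxE. Qed.
Lemma qform_congr m n (v : 'rV[C]_m) (T : 'M[C]_(m, n)) A :
  qform v (T *m A *m T^H) = qform (v *m T) A.
Proof. by rewrite /qform adjmxM !mulmxA. Qed.
Lemma qform_row m n (T : 'M[C]_(m, n)) A i :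
  qform (row i T) A = (T *m A *m T^H) i i.
Proof.
rewrite /qform -row_mul [LHS]mxE [RHS]mxE; apply: eq_bigr => k _.
by rewrite !adjmxE !mxE.
Qed.
Lemma qform_rdiag n (v : 'rV[C]_n) e :
  qform v (rdiag e) = \sum_i rC (e i) * (v 0 i * (v 0 i)^*).
Proof.
rewrite /qform mxE; apply: eq_bigr => i _.
by rewrite mul_rdiagr adjmxE [v 0 i * rC _]mulrC mulrA.
Qed.
Lemma qform_real n (v : 'rV[C]_n) A : herm A -> qform v A \is Num.real.
Proof.
move=> hA; apply/CrealP; rewrite /qform -adjmxE !adjmxM adjmxK hA.
by rewrite mulmxA.
Qed.

Lemma psd_congr m n (T : 'M[C]_(m, n)) A : possemidef A -> possemidef (T *m A *m T^H).
Proof.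
case/psdP => hA H; apply/psdP; split; first exact: herm_congr.
by move=> v; rewrite qform_congr.
Qed.
Lemma posdef_congr n (T : 'M[C]_n) A : T \in unitmx -> posdef A ->
  posdef (T *m A *m T^H).
Proof.
move=> uT /posdefP [hA H]; apply/posdefP; split; first exact: herm_congr.
move=> v v0; rewrite qform_congr H //; apply: contra_neq v0 => v0.
by rewrite -[v](mulmxK uT) v0 mul0mx.
Qed.
Lemma psd1 n : possemidef (1%:M : 'M[C]_n).
Proof.
apply/psdP; split; first exact: adjmx1.
move=> v; rewrite -rdiag1 qform_rdiag; apply: sumr_ge0 => i _.
by rewrite mulr_ge0 ?mul_conjC_ge0 // (rC_le 0 1).
Qed.
Lemma psd_gram m n (T : 'M[C]_(m, n)) : possemidef (T *m T^H).
Proof. by rewrite -{1}[T]mulmx1; apply: psd_congr; apply: psd1. Qed.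

Lemma psd_eig n P e (A : 'M[C]_n) : diagonalizes P e A -> possemidef A ->
  forall i, 0 <= e i.
Proof.
move=> [uP uP' ->] /psd_ge0 H i; move: (H (row i P)).
rewrite qform_row !mulmxA uP mul1mx -mulmxA uP mulmx1 rdiagE eqxx.
by rewrite (rC_le 0).
Qed.
Lemma unitary_row_neq0 n (P : 'M[C]_n) i : P *m P^H = 1%:M -> row i P != 0.
Proof.
move=> uP; apply/eqP => P0.
have /matrixP/(_ i i) := uP; rewrite !mxE eqxx big1 => [/eqP|k _].
  by rewrite eq_sym oner_eq0.
by move/rowP/(_ k): P0; rewrite !mxE => ->; rewrite mul0r.
Qed.
Lemma posdef_eig n P e (A : 'M[C]_n) : diagonalizes P e A -> posdef A ->
  forall i, 0 < e i.
Proof.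
move=> [uP uP' ->] /posdefP [_ H] i; have := H (row i P).
rewrite qform_row !mulmxA uP mul1mx -mulmxA uP mulmx1 rdiagE eqxx.
by rewrite (rC_lt 0); apply; exact: unitary_row_neq0.
Qed.
Lemma eig_psd n P e (A : 'M[C]_n) : diagonalizes P e A -> (forall i, 0 <= e i) ->
  possemidef A.
Proof.
move=> dA e0; apply/psdP; split; first exact: diag_herm dA.
have [_ _ ->] := dA.
move=> v; rewrite -[X in _ *m X](adjmxK P) qform_congr qform_rdiag.
by apply: sumr_ge0 => i _; rewrite mulr_ge0 ?mul_conjC_ge0 // (rC_le 0).
Qed.
Lemma eig_posdef n P e (A : 'M[C]_n) : diagonalizes P e A -> (forall i, 0 < e i) ->
  posdef A.
Proof.
move=> dA e0; apply/posdefP; split; first exact: diag_herm dA.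
have [uP uP' ->] := dA.
move=> v v0; rewrite -[X in _ *m X](adjmxK P) qform_congr qform_rdiag.
have {v0} : v *m P^H != 0.
  by apply: contra_neq v0 => v0; rewrite -[v]mulmx1 -uP' mulmxA v0 mul0mx.
set w := v *m _ => /rV0Pn [i wi].
rewrite (bigD1 i) //= ltr_pwDl //.
  by rewrite mulr_gt0 ?mul_conjC_gt0 // (rC_lt 0).
by apply: sumr_ge0 => j _; rewrite mulr_ge0 ?mul_conjC_ge0 // (rC_le 0) ltW.
Qed.

Lemma mxfun_psd n (A : 'M[C]_n) f : possemidef A -> (forall x, 0 <= x -> 0 <= f x) ->
  possemidef (mxfun f A).
Proof.
move=> pA f0; have dA := herm_diag (psd_herm pA).
by apply: (eig_psd (diag_mxfun f dA)) => i; apply/f0/(psd_eig dA).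
Qed.
Lemma mxfun_posdef_psd n (A : 'M[C]_n) f : possemidef A -> (forall x, 0 <= x -> 0 < f x) ->
  posdef (mxfun f A).
Proof.
move=> pA f0; have dA := herm_diag (psd_herm pA).
by apply: (eig_posdef (diag_mxfun f dA)) => i; apply/f0/(psd_eig dA).
Qed.
Lemma mxfun_posdef n (A : 'M[C]_n) f : posdef A -> (forall x, 0 < x -> 0 < f x) ->
  posdef (mxfun f A).
Proof.
move=> pA f0; have dA := herm_diag (posdef_herm pA).
by apply: (eig_posdef (diag_mxfun f dA)) => i; apply/f0/(posdef_eig dA).
Qed.
Lemma eq_mxfun_psd n (A : 'M[C]_n) f g : possemidef A ->
  (forall x, 0 <= x -> f x = g x) -> mxfun f A = mxfun g A.
Proof.
move=> pA fg; have dA := herm_diag (psd_herm pA).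
rewrite !(mxfun_diag _ dA); congr (_ *m _ *m _); apply: eq_rdiag => i /=.
exact/fg/(psd_eig dA).
Qed.
Lemma eq_mxfun_posdef n (A : 'M[C]_n) f g : posdef A ->
  (forall x, 0 < x -> f x = g x) -> mxfun f A = mxfun g A.
Proof.
move=> pA fg; have dA := herm_diag (posdef_herm pA).
rewrite !(mxfun_diag _ dA); congr (_ *m _ *m _); apply: eq_rdiag => i /=.
exact/fg/(posdef_eig dA).
Qed.

Definition mxsqrt n (A : 'M[C]_n) := mxfun Num.sqrt A.
Lemma mxsqrt_herm n (A : 'M[C]_n) : possemidef A -> herm (mxsqrt A).
Proof. by move/psd_herm; apply: mxfun_herm. Qed.
Lemma mxsqrtK n (A : 'M[C]_n) : possemidef A -> mxsqrt A *m mxsqrt A = A.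
Proof.
move=> pA; rewrite mxfunM; last exact: psd_herm.
rewrite -[RHS](mxfun_id (psd_herm pA)); apply: eq_mxfun_psd => // x x0.
by rewrite -expr2 sqr_sqrtr.
Qed.

Lemma tr_mulmx_psd n (W : 'M[C]_n) A : possemidef W ->
  \tr (A *m W) = \sum_i qform (row i (mxsqrt W)) A.
Proof.
move=> pW; rewrite -{1}(mxsqrtK pW) mulmxA mxtrace_mulC mulmxA.
by apply: eq_bigr => i _; rewrite qform_row mxsqrt_herm.
Qed.

Definition lemx n (A B : 'M[C]_n) := forall v, qform v A <= qform v B.

Lemma tr_lemx n (W A B : 'M[C]_n) : possemidef W -> lemx A B ->
  \tr (A *m W) <= \tr (B *m W).
Proof. by move=> pW AB; rewrite !tr_mulmx_psd //; apply: ler_sum. Qed.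

Definition cvx m n (t : R) (A B : 'M[C]_(m, n)) := rC t *: A + rC (1 - t) *: B.

Lemma cvx_posdef n t (A B : 'M[C]_n) : 0 <= t <= 1 -> posdef A -> posdef B ->
  posdef (cvx t A B).
Proof.
move=> /andP[t0 t1] /posdefP [hA pA] /posdefP [hB pB]; apply/posdefP; split.
  by rewrite /herm adjmxD !adjmxZ hA hB.
move=> v v0; rewrite qformD !qformZ.
(* Strictness is taken from the first summand, which vanishes at [t = 0]. *)
have [->|tn] := eqVneq t 0.
  by rewrite subr0 (_ : rC 0 = 0) // mul0r add0r (_ : rC 1 = 1) // mul1r pB.
rewrite ltr_pwDl // ?mulr_gt0 ?pA // ?mulr_ge0 ?(rC_lt 0) ?(rC_le 0) ?subr_ge0 //.
  by rewrite lt_neqAle eq_sym tn.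
exact/ltW/pB.
Qed.

Lemma posdef_unit n (A : 'M[C]_n) : posdef A -> A \in unitmx.
Proof.
move=> /posdefP [_ pA]; rewrite -row_free_unit -kermx_eq0; apply/eqP/row_matrixP => i.
rewrite row0; apply/eqP; apply/negP => /negP /pA.
rewrite /qform -row_mul mulmx_ker row0 mul0mx mxE ltxx.
by [].
Qed.

End Positivity.

(** * Real powers of a positive definite matrix *)

Section Powers.
Variable R : realType.
Local Notation C := (R[i]).
Variables (n : nat) (A : 'M[C]_n).
Hypothesis pA : posdef A.

Lemma mxpow_posdef a : posdef (mxpow A a).
Proof. by apply: mxfun_posdef => // x x0; rewrite powR_gt0. Qed.
Lemma mxpow_herm a : herm (mxpow A a).
Proof. exact/posdef_herm/mxpow_posdef. Qed.
Lemma mxpowD a b : mxpow A a *m mxpow A b = mxpow A (a + b).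
Proof.
rewrite mxfunM; last exact: posdef_herm.
by apply: eq_mxfun_posdef => // x x0; rewrite -powRD // (gt_eqF x0) implybT.
Qed.
Lemma mxpow0 : mxpow A 0 = 1%:M.
Proof. by apply: mxfun_1 => [|x]; [exact: posdef_herm | rewrite powRr0]. Qed.
Lemma mxpow1 : mxpow A 1 = A.
Proof.
rewrite -[RHS](mxfun_id (posdef_herm pA)); apply: eq_mxfun_posdef => // x x0.
by rewrite powRr1 // ltW.
Qed.
Lemma mxpowM a b : mxpow (mxpow A a) b = mxpow A (a * b).
Proof.
rewrite /mxpow mxfun_comp; last exact: posdef_herm.
by apply: eq_mxfun_posdef => // x x0 /=; rewrite powRrM.
Qed.
Lemma mxpowVl a : mxpow A (- a) *m mxpow A a = 1%:M.
Proof. by rewrite mxpowD addNr mxpow0. Qed.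
Lemma mxpowVr a : mxpow A a *m mxpow A (- a) = 1%:M.
Proof. by rewrite mxpowD addrN mxpow0. Qed.
Lemma invmx_mxpow a : invmx (mxpow A a) = mxpow A (- a).
Proof.
have u : mxpow A a \in unitmx by exact/posdef_unit/mxpow_posdef.
by rewrite -[RHS]mulmx1 -(mulmxV u) mulmxA mxpowVl mul1mx.
Qed.
Lemma mxpowN1 : invmx A = mxpow A (-1).
Proof. by rewrite -invmx_mxpow mxpow1. Qed.
End Powers.

(** * The geometric mean through 2x2 block inequalities *)

Section GeometricMean.
Variable R : realType.
Local Notation C := (R[i]).

Definition bform n (x : 'rV[C]_n) (A : 'M[C]_n) (y : 'rV[C]_n) : C :=
  (x *m A *m y^H) 0 0.

Lemma bformD n (x y : 'rV[C]_n) A B : bform x (A + B) y = bform x A y + bform x B y.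
Proof. by rewrite /bform mulmxDr mulmxDl mxE. Qed.
Lemma bformZ n (x y : 'rV[C]_n) (a : C) A : bform x (a *: A) y = a * bform x A y.
Proof. by rewrite /bform -scalemxAr -scalemxAl mxE. Qed.

(** The squared norm of [x D - y D'] is nonnegative, and [D D' = 1] removes [D] from the cross
    terms. *)
Lemma am_gm_form n (D D' : 'M[C]_n) (x y : 'rV[C]_n) :
  herm D -> herm D' -> D *m D' = 1%:M ->
  bform x 1%:M y + bform y 1%:M x <= qform x (D *m D) + qform y (D' *m D').
Proof.
move=> hD hD' DD'; have D'D : D' *m D = 1%:M by exact: mulmx1C.
have := psd_ge0 (x *m D + -1 *: (y *m D')) (psd1 R n).
have hN : (-1 *: (y *m D'))^H = -1 *: (D' *m y^H).
  by rewrite (_ : -1 = rC (-1)) ?adjmxZ ?adjmxM ?hD' // -(rmorphN1 (real_complex R)).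
rewrite /qform /bform !mulmx1 adjmxD adjmxM hD hN mulmxDl !mulmxDr.
rewrite -!scalemxAl -!scalemxAr !mulmxA.
rewrite -(mulmxA x D D') -(mulmxA y D' D) DD' D'D !mulmx1 scalerA mulrNN mulr1 scale1r.
rewrite !scaleN1r => H; rewrite -subr_ge0; apply: le_trans H _.
by rewrite !mxE le_eqVlt; apply/orP; left; apply/eqP; ring.
Qed.

(** The mean [M = L^2] is itself a solution of the block inequality of which [geometric_mean_max]
    shows it to be the largest. *)
Lemma am_gm_congr n (L D D' T T' M S S' : 'M[C]_n) (x y : 'rV[C]_n) :
  herm L -> herm D -> herm D' -> D *m D' = 1%:M ->
  D *m D = T -> D' *m D' = T' ->
  L *m L = M -> L *m T *m L = S -> L *m T' *m L = S' ->
  bform x M y + bform y M x <= qform x S + qform y S'.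
Proof.
move=> hL hD hD' DD' <- <- <- <- <-; have := am_gm_form (x *m L) (y *m L) hD hD' DD'.
rewrite -!qform_congr hL.
have bE u v : bform (u *m L) 1%:M (v *m L) = bform u (L *m L) v.
  by rewrite /bform adjmxM hL mulmx1 !mulmxA.
by rewrite !bE.
Qed.

(* [L *m L] is the geometric mean of [L *m T *m L] and [L *m T^-1 *m L]: it is
   the largest Hermitian [G] making the corresponding 2x2 block matrix positive.
   For an eigenvector [v] of [L^-1 G L^-1], test the block form on [v L^-1] and
   [v T L^-1]. *)
Lemma geometric_mean_max n (L L' T T' G M S S' : 'M[C]_n) :
  herm L -> herm L' -> posdef T -> herm G ->
  L *m L' = 1%:M -> T *m T' = 1%:M ->
  L *m L = M -> L *m T *m L = S -> L *m T' *m L = S' ->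
  (forall x y, bform x G y + bform y G x <= qform x S + qform y S') ->
  lemx G M.
Proof.
move=> hL hL' pT hG LL' TT' <- <- <- H.
have L'L : L' *m L = 1%:M by exact: mulmx1C.
have hT := posdef_herm pT.
pose G' := L' *m G *m L'.
have hG' : herm G' by rewrite /herm !adjmxM hL' hG mulmxA.
have dG := herm_diag hG'; move: dG; set P := spectralmx G'; set e := (fun i => _).
move=> [uP uP' EG].
have e1 i : e i <= 1.
  pose v := row i P.
  have v0 : v != 0 by exact: unitary_row_neq0.
  have vG : v *m G' = rC (e i) *: v.
    rewrite /v EG -row_mul !mulmxA uP mul1mx; apply/rowP => j.
    by rewrite [LHS]mxE mul_rdiagl !mxE.
  have Gv : G' *m v^H = rC (e i) *: v^H.
    by rewrite -[in LHS]hG' -adjmxM vG adjmxZ.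
  have k0 : 0 < qform v T by case/posdefP: pT => _; apply.
  have := H (v *m L') (v *m T *m L').
  have -> : bform (v *m L') G (v *m T *m L') = rC (e i) * qform v T.
    rewrite /bform !adjmxM hL' hT !mulmxA -2!(mulmxA v) -/G' vG.
    by rewrite -!scalemxAl mxE.
  have -> : bform (v *m T *m L') G (v *m L') = rC (e i) * qform v T.
    rewrite /bform adjmxM hL' !mulmxA -(mulmxA (v *m T) L') -(mulmxA (v *m T)) -/G'.
    by rewrite -(mulmxA _ G') Gv -scalemxAr mxE.
  have -> : qform (v *m L') (L *m T *m L) = qform v T.
    rewrite -qform_congr hL' !mulmxA L'L mul1mx.
    by rewrite -(mulmxA T L L') LL' mulmx1.
  have -> : qform (v *m T *m L') (L *m T' *m L) = qform v T.
    rewrite -(mulmxA v) -qform_congr adjmxM hT hL' !mulmxA.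
    rewrite -(mulmxA T L' L) L'L mulmx1 TT' mul1mx.
    by rewrite LL' mul1mx.
  rewrite -!mulr2n lerMn2r /= -subr_ge0 -{1}[qform v T]mul1r -mulrBl.
  by rewrite pmulr_lge0 // subr_ge0 (rC_le _ 1).
move=> w; have -> : qform w G = qform (w *m L) G'.
  by rewrite -qform_congr hL /G' !mulmxA LL' mul1mx -(mulmxA G) L'L mulmx1.
have -> : qform w (L *m L) = qform (w *m L) 1%:M by rewrite -qform_congr hL mulmx1.
have -> : qform (w *m L) G' = qform (w *m L *m P^H) (rdiag e).
  by rewrite -(qform_congr (w *m L) P^H) adjmxK EG.
have -> : qform (w *m L) 1%:M = qform (w *m L *m P^H) (rdiag (fun=> 1)).
  by rewrite -(qform_congr (w *m L) P^H) adjmxK rdiag1 mulmx1 uP'.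
rewrite !qform_rdiag.
by apply: ler_sum => i _; rewrite ler_wpM2r ?mul_conjC_ge0 // rC_le.
Qed.

Lemma herm_cvx n t (A B : 'M[C]_n) : herm A -> herm B -> herm (cvx t A B).
Proof. by move=> hA hB; rewrite /herm adjmxD !adjmxZ hA hB. Qed.

(** The block inequality is linear in its three matrices; together with maximality, this makes the
    geometric mean jointly concave. *)
Lemma block_form_cvx n t (G1 G2 S1 S2 T1 T2 : 'M[C]_n) x y : 0 <= t <= 1 ->
  bform x G1 y + bform y G1 x <= qform x S1 + qform y T1 ->
  bform x G2 y + bform y G2 x <= qform x S2 + qform y T2 ->
  bform x (cvx t G1 G2) y + bform y (cvx t G1 G2) x <=
  qform x (cvx t S1 S2) + qform y (cvx t T1 T2).
Proof.
move=> /andP[t0 t1] H1 H2.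
rewrite !bformD !bformZ !qformD !qformZ addrACA [leRHS]addrACA -!mulrDr.
by apply: lerD; apply: ler_wpM2l; rewrite ?(rC_le 0) ?subr_ge0.
Qed.

End GeometricMean.

(** * Tensor products and transposes under functional calculus *)

Section Tensor.
Variable R : realType.
Local Notation C := (R[i]).

Lemma adjmx_tens m n p q (A : 'M[C]_(m, n)) (B : 'M[C]_(p, q)) :
  (A *t B)^H = A^H *t B^H.
Proof. by apply/matrixP => i j; rewrite !(mxE, adjmxE) rmorphM. Qed.
Lemma tensmxM m n p q r s (A : 'M[C]_(m, n)) (B : 'M[C]_(p, q))
    (D : 'M[C]_(n, r)) (E : 'M[C]_(q, s)) :
  (A *t B) *m (D *t E) = (A *m D) *t (B *m E).
Proof. exact: mxtens.tensmx_mul. Qed.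
Lemma tensmxDl m n p q (A B : 'M[C]_(m, n)) (D : 'M[C]_(p, q)) :
  (A + B) *t D = A *t D + B *t D.
Proof. by apply/matrixP => i j; rewrite !mxE mulrDl. Qed.
Lemma tensmxDr m n p q (A B : 'M[C]_(m, n)) (D : 'M[C]_(p, q)) :
  D *t (A + B) = D *t A + D *t B.
Proof. by apply/matrixP => i j; rewrite !mxE mulrDr. Qed.
Lemma tensmxZl m n p q a (A : 'M[C]_(m, n)) (D : 'M[C]_(p, q)) :
  (a *: A) *t D = a *: (A *t D).
Proof. by apply/matrixP => i j; rewrite !mxE mulrA. Qed.
Lemma tensmxZr m n p q a (A : 'M[C]_(m, n)) (D : 'M[C]_(p, q)) :
  D *t (a *: A) = a *: (D *t A).
Proof. by apply/matrixP => i j; rewrite !mxE mulrCA. Qed.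

Lemma sum_mxtens n m (F : 'I_(n * m) -> C) :
  \sum_k F k = \sum_i \sum_j F (mxtens.mxtens_index (i, j)).
Proof.
rewrite pair_big /= (reindex (@mxtens.mxtens_index n m)) /=.
  by apply: eq_bigr => -[i j].
exists (@mxtens.mxtens_unindex n m) => k _.
  exact: mxtens.mxtens_indexK.
exact: mxtens.mxtens_unindexK.
Qed.

Lemma rdiag_tens m n (d : 'I_m -> R) (e : 'I_n -> R) :
  rdiag d *t rdiag e =
  rdiag (fun k => d (mxtens.mxtens_unindex k).1 * e (mxtens.mxtens_unindex k).2).
Proof.
apply/matrixP => i j.
case: (mxtens.mxtens_indexP i) => i1 i2; case: (mxtens.mxtens_indexP j) => j1 j2.
rewrite mxtens.tensmxE !rdiagE !mxtens.mxtens_indexK.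
rewrite (can_eq (@mxtens.mxtens_indexK m n)) xpair_eqE /=.
by case: (i1 == j1); case: (i2 == j2); rewrite /= ?mulr1n ?mulr0n ?mulr0 ?mul0r ?rCM.
Qed.
Lemma tens11 m n : (1%:M : 'M[C]_m) *t (1%:M : 'M[C]_n) = 1%:M.
Proof.
rewrite -!rdiag1 rdiag_tens; apply: eq_rdiag => k; exact: mulr1.
Qed.

Lemma tens_diag m n P d (A : 'M[C]_m) Q e (B : 'M[C]_n) :
  diagonalizes P d A -> diagonalizes Q e B ->
  diagonalizes (P *t Q)
    (fun k => d (mxtens.mxtens_unindex k).1 * e (mxtens.mxtens_unindex k).2) (A *t B).
Proof.
move=> [uP uP' ->] [uQ uQ' ->]; split; rewrite adjmx_tens.
- by rewrite tensmxM uP uQ tens11.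
- by rewrite tensmxM uP' uQ' tens11.
- by rewrite -rdiag_tens !tensmxM.
Qed.

Lemma tens_posdef m n (A : 'M[C]_m) (B : 'M[C]_n) :
  posdef A -> posdef B -> posdef (A *t B).
Proof.
move=> pA pB; have dA := herm_diag (posdef_herm pA).
have dB := herm_diag (posdef_herm pB).
apply: (eig_posdef (tens_diag dA dB)) => k.
by rewrite mulr_gt0 ?(posdef_eig dA) ?(posdef_eig dB).
Qed.

Lemma diag1 n : diagonalizes (1%:M : 'M[C]_n) (fun=> 1) 1%:M.
Proof. by split; rewrite ?adjmx1 ?rdiag1 ?mulmx1. Qed.

Lemma posdef1 n : posdef (1%:M : 'M[C]_n).
Proof. exact: (eig_posdef (diag1 n)). Qed.

Lemma mxpow_id n a : mxpow (1%:M : 'M[C]_n) a = 1%:M.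
Proof.
rewrite /mxpow (mxfun_diag _ (diag1 n)) adjmx1 mul1mx mulmx1 -[RHS]rdiag1.
by apply: eq_rdiag => i /=; rewrite powR1.
Qed.

Lemma mxfun_ampl k n (A : 'M[C]_n) f : herm A ->
  mxfun f ((1%:M : 'M[C]_k) *t A) = 1%:M *t mxfun f A.
Proof.
move=> /herm_diag; move: (spectralmx A) (fun i => complex.Re _) => P e dA.
rewrite (mxfun_diag _ dA) (mxfun_diag _ (tens_diag (diag1 k) dA)).
have -> : rdiag (f \o fun i : 'I_(k * n) => 1 * e (mxtens.mxtens_unindex i).2) =
    rdiag (fun _ : 'I_k => 1) *t rdiag (f \o e).
  by rewrite rdiag_tens; apply: eq_rdiag => i /=; rewrite !mul1r.
by rewrite adjmx_tens adjmx1 !tensmxM rdiag1 !mul1mx.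
Qed.

(** Transposition keeps the eigenvalues and conjugates the unitary entrywise, which is what
    [(P^H)^T] is. *)
Lemma diag_tr n P e (A : 'M[C]_n) : diagonalizes P e A -> diagonalizes (P^H)^T e A^T.
Proof.
have hT (X : 'M[C]_n) : (X^T)^H = (X^H)^T.
  by apply/matrixP => i j; rewrite !(mxE, adjmxE).
case=> uP uP' E; split.
- by rewrite hT -trmx_mul adjmxK uP trmx1.
- by rewrite hT -trmx_mul adjmxK uP' trmx1.
- rewrite E !trmx_mul hT adjmxK mulmxA; congr (_ *m _ *m _).
  by apply/matrixP => i j; rewrite [LHS]mxE !rdiagE eq_sym; case: eqP => // ->.
Qed.

Lemma posdef_tr n (A : 'M[C]_n) : posdef A -> posdef A^T.
Proof.
move=> pA; have dA := herm_diag (posdef_herm pA).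
by apply: (eig_posdef (diag_tr dA)) => i; apply: (posdef_eig dA).
Qed.

Lemma mxpow_tr n (A : 'M[C]_n) a : posdef A -> mxpow A^T a = (mxpow A a)^T.
Proof.
move=> pA; have dA := herm_diag (posdef_herm pA).
rewrite /mxpow (mxfun_diag _ (diag_tr dA)).
by have [_ _ ->] := diag_tr (diag_mxfun (fun x => powR x a) dA).
Qed.

Lemma cvx_tr m n t (A B : 'M[C]_(m, n)) : (cvx t A B)^T = cvx t A^T B^T.
Proof. by rewrite /cvx linearD !linearZ. Qed.

End Tensor.

(** * Ando's concavity: the set of good exponents is closed under midpoints *)

Section Ando.
Variable R : realType.
Local Notation C := (R[i]).
Variables (n m : nat).
Implicit Types (A : 'M[C]_n) (V : 'M[C]_m).

(** Powers of the commuting pair [A (x) 1] and [1 (x) V], so that exponents add coordinatewise. *)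
Definition tpow A V (a b : R) := mxpow A a *t mxpow V b.

Lemma tpow_posdef A V a b : posdef A -> posdef V -> posdef (tpow A V a b).
Proof. by move=> pA pV; apply: tens_posdef; apply: mxpow_posdef. Qed.
Lemma tpow_herm A V a b : posdef A -> posdef V -> herm (tpow A V a b).
Proof. by move=> pA pV; apply/posdef_herm/tpow_posdef. Qed.
Lemma tpowM A V a b c d : posdef A -> posdef V ->
  tpow A V a b *m tpow A V c d = tpow A V (a + c) (b + d).
Proof. by move=> pA pV; rewrite tensmxM !mxpowD. Qed.
Lemma tpow0 A V : posdef A -> posdef V -> tpow A V 0 0 = 1%:M.
Proof. by move=> pA pV; rewrite /tpow !mxpow0 // tens11. Qed.

Lemma tpowE A V a b c d e f : posdef A -> posdef V -> a + c = e -> b + d = f ->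
  tpow A V a b *m tpow A V c d = tpow A V e f.
Proof. by move=> pA pV <- <-; exact: tpowM. Qed.
Lemma tpowV A V a b c d : posdef A -> posdef V -> a + c = 0 -> b + d = 0 ->
  tpow A V a b *m tpow A V c d = 1%:M.
Proof. by move=> pA pV ac bd; rewrite -(tpow0 pA pV); exact: tpowE. Qed.
Lemma tpow_congrE A V a b c d e f : posdef A -> posdef V ->
  a + c + a = e -> b + d + b = f ->
  tpow A V a b *m tpow A V c d *m tpow A V a b = tpow A V e f.
Proof. by move=> pA pV <- <-; rewrite !tpowM. Qed.

Variables (A1 A2 : 'M[C]_n) (V1 V2 : 'M[C]_m) (t : R).
Hypotheses (pA1 : posdef A1) (pA2 : posdef A2) (pV1 : posdef V1) (pV2 : posdef V2).
Hypothesis (t01 : 0 <= t <= 1).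

(** Concavity at a single exponent and for four fixed matrices, so that the set of exponents where
    it holds can be studied. *)
Definition ando_at (r : R) :=
  lemx (cvx t (tpow A1 V1 r (1 - r)) (tpow A2 V2 r (1 - r)))
       (tpow (cvx t A1 A2) (cvx t V1 V2) r (1 - r)).

Let pA := cvx_posdef t01 pA1 pA2.
Let pV := cvx_posdef t01 pV1 pV2.

Lemma ando0 : ando_at 0.
Proof.
by move=> v; rewrite /tpow subr0 !mxpow0 // !mxpow1 // /cvx tensmxDr !tensmxZr.
Qed.
Lemma ando1 : ando_at 1.
Proof.
by move=> v; rewrite /tpow subrr !mxpow0 // !mxpow1 // /cvx tensmxDl !tensmxZl.
Qed.

Lemma am_gm_tpow A V (r s : R) x y : posdef A -> posdef V ->
  bform x (tpow A V ((r + s) / 2) (1 - (r + s) / 2)) y +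
  bform y (tpow A V ((r + s) / 2) (1 - (r + s) / 2)) x <=
  qform x (tpow A V r (1 - r)) + qform y (tpow A V s (1 - s)).
Proof.
move=> pA' pV'.
have hp a b : herm (tpow A V a b) by exact: tpow_herm.
(* [L] carries half the exponents of the midpoint; [D^2] and [D'^2] shift by half of [r - s] in
   opposite directions, so that [L D^2 L] and [L D'^2 L] are the powers at [r] and at [s]. *)
apply: (am_gm_congr x y (hp ((r + s) / 4) ((1 - (r + s) / 2) / 2))
  (hp ((r - s) / 4) ((s - r) / 4)) (hp ((s - r) / 4) ((r - s) / 4))).
- by apply: tpowV => //; lra.
- by apply: (@tpowE _ _ _ _ _ _ ((r - s) / 2) ((s - r) / 2)) => //; lra.
- by apply: (@tpowE _ _ _ _ _ _ ((s - r) / 2) ((r - s) / 2)) => //; lra.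
- by apply: tpowE => //; lra.
- by apply: tpow_congrE => //; lra.
- by apply: tpow_congrE => //; lra.
Qed.

(** The power at the midpoint is the geometric mean of the powers at [r] and [s]. The combination of
    two such means satisfies the block inequality with the combined diagonal blocks; [Hr] and [Hs]
    enlarge these to the powers at the combined point, where maximality applies. *)
Lemma ando_midpoint (r s : R) : ando_at r -> ando_at s -> ando_at ((r + s) / 2).
Proof.
move=> Hr Hs.
have hp a b : herm (tpow (cvx t A1 A2) (cvx t V1 V2) a b) by exact: tpow_herm.
apply: (geometric_mean_max (hp ((r + s) / 4) ((1 - (r + s) / 2) / 2))
  (hp (- ((r + s) / 4)) (- ((1 - (r + s) / 2) / 2)))
  (tpow_posdef ((r - s) / 2) ((s - r) / 2) pA pV)
  (T' := tpow (cvx t A1 A2) (cvx t V1 V2) ((s - r) / 2) ((r - s) / 2))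
  (S := tpow (cvx t A1 A2) (cvx t V1 V2) r (1 - r))
  (S' := tpow (cvx t A1 A2) (cvx t V1 V2) s (1 - s))).
- by apply: herm_cvx; apply: tpow_herm.
- by apply: tpowV => //; lra.
- by apply: tpowV => //; lra.
- by apply: tpowE => //; lra.
- by apply: tpow_congrE => //; lra.
- by apply: tpow_congrE => //; lra.
move=> x y.
apply: le_trans (lerD (Hr x) (Hs y)).
by apply: block_form_cvx => //; apply: am_gm_tpow.
Qed.

End Ando.

(** * From a dense set of exponents to all of them *)

Section Dyadic.
Variable R : realType.

(** Halving repeatedly an interval around [r] with both endpoints in [E] shows that [E] is dense. *)
Lemma bisection (E : R -> Prop) : E 0 -> E 1 ->
  (forall r s, E r -> E s -> E ((r + s) / 2)) ->
  forall r, 0 <= r <= 1 -> forall d, 0 < d -> exists2 s, E s & `|r - s| < d.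
Proof.
move=> E0 E1 Em r /andP[r0 r1] d d0.
have H n : exists lo hi, [/\ E lo, E hi, lo <= r, r <= hi & hi - lo = 2 ^- n].
  elim: n => [|n [lo [hi [El Eh lr rh hl]]]].
    by exists 0, 1; split => //; rewrite subr0 expr0 invr1.
  have E2 : 2 ^- n.+1 = (hi - lo) / 2 by rewrite hl exprS invfM mulrC.
  have [mr|rm] := leP ((lo + hi) / 2) r.
    by exists ((lo + hi) / 2), hi; split => //; [exact: Em | rewrite E2; lra].
  by exists lo, ((lo + hi) / 2); split => //; [exact: Em | exact: ltW | rewrite E2; lra].
(* This [n] exceeds [1 / d], and [2 ^ n] is at least [n], so the interval is shorter than [d]. *)
pose n := (Num.trunc d^-1).+1.
have [lo [hi [El _ lr rh hl]]] := H n; exists lo => //.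
rewrite ger0_norm ?subr_ge0 //; apply: (@le_lt_trans _ _ (2 ^- n)); first by lra.
rewrite -[d]invrK ltf_pV2 ?posrE ?invr_gt0 ?exprn_gt0 //.
apply: (@lt_le_trans _ _ n%:R); first by rewrite /n truncnS_gt.
by rewrite -natrX ler_nat ltnW // ltn_expl.
Qed.

Lemma continuous_powR_sum N (c a b : 'I_N -> R) : (forall k, 0 < a k) ->
  (forall k, 0 < b k) ->
  continuous (fun r : R => \sum_k c k * (powR (a k) r * powR (b k) (1 - r))).
Proof.
move=> a0 b0 r; apply: cvg_big => [|k _]; first exact: add_continuous.
apply: cvgMl_tmp; pose g (s : R) := s * ln (a k) + (1 - s) * ln (b k).
have -> : (fun s : R => powR (a k) s * powR (b k) (1 - s)) = expR \o g.
  by apply/funext => s; rewrite /powR !gt_eqF // /= expRD.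
have -> : powR (a k) r * powR (b k) (1 - r) = expR (g r).
  by rewrite /powR !gt_eqF // expRD.
apply: (continuous_comp (f := g) (g := expR)); last exact: continuous_expR.
apply: cvgD; apply: cvgMr_tmp; first exact: cvg_id.
by apply: cvgB; [exact: cvg_cst | exact: cvg_id].
Qed.

Lemma closed_nonpos (f : R -> R) (E : R -> Prop) r : {for r, continuous f} ->
  (forall d, 0 < d -> exists2 s, E s & `|r - s| < d) ->
  (forall s, E s -> f s <= 0) -> f r <= 0.
Proof.
move=> fr Er Ef; rewrite leNgt; apply/negP => fr0.
move/cvgrPdist_lt: fr => /(_ _ fr0) /nbhs_ballP [d /= d0 H].
have [s /Ef fs0 rs] := Er _ d0.
have := H s rs; rewrite /= ltNge => /negP; apply.
by rewrite ger0_norm; lra.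
Qed.

End Dyadic.

(** * Ando's inequality at all exponents and Lieb's concavity theorem *)

Section Lieb.
Variable R : realType.
Local Notation C := (R[i]).

(** The joint eigenbasis does not depend on [r]: the exponent enters through scalar powers only, and
    the limit over exponents becomes a scalar one. *)
Lemma qform_tpow n m (A : 'M[C]_n) (V : 'M[C]_m) v : posdef A -> posdef V ->
  exists c a b : 'I_(n * m) -> R, [/\ forall k, 0 < a k, forall k, 0 < b k &
    forall r, qform v (tpow A V r (1 - r)) =
      rC (\sum_k c k * (powR (a k) r * powR (b k) (1 - r)))].
Proof.
move=> pA pV; have dA := herm_diag (posdef_herm pA); have dV := herm_diag (posdef_herm pV).
move: (spectralmx A) (fun i => complex.Re (spectral_diag A 0 i)) dA => P d dA.
move: (spectralmx V) (fun i => complex.Re (spectral_diag V 0 i)) dV => Q e dV.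
pose w := v *m (P *t Q)^H.
exists (fun k => complex.Re (w 0 k * (w 0 k)^*)).
exists (fun k => d (mxtens.mxtens_unindex k).1), (fun k => e (mxtens.mxtens_unindex k).2).
split=> [k|k|r]; [exact: (posdef_eig dA) | exact: (posdef_eig dV) |].
have /diag_eq E := tens_diag (diag_mxfun (fun x => powR x r) dA)
                           (diag_mxfun (fun x => powR x (1 - r)) dV).
have -> : qform v (tpow A V r (1 - r)) = qform w (rdiag (fun k =>
    powR (d (mxtens.mxtens_unindex k).1) r * powR (e (mxtens.mxtens_unindex k).2) (1 - r))).
  by rewrite -qform_congr adjmxK -E.
rewrite qform_rdiag rC_sum.
apply: eq_bigr => k _; rewrite [RHS]rCM [RHS]mulrC; congr (_ * _).
by rewrite -rC_real // ger0_real // mul_conjC_ge0.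
Qed.

Lemma qform_cvx n (v : 'rV[C]_n) t X Y :
  qform v (cvx t X Y) = rC t * qform v X + rC (1 - t) * qform v Y.
Proof. by rewrite qformD !qformZ. Qed.

Lemma qform_cvx_rC n (v : 'rV[C]_n) t X Y x y : qform v X = rC x -> qform v Y = rC y ->
  qform v (cvx t X Y) = rC (t * x + (1 - t) * y).
Proof. by move=> X_x Y_y; rewrite qform_cvx X_x Y_y [RHS]rCD !rCM. Qed.

Lemma le_rC (u v : C) (x y : R) : u = rC x -> v = rC y -> u <= v <-> x <= y.
Proof. by move=> -> ->; rewrite rC_le. Qed.

Lemma le_lincomb_eq (a b x y z x' y' z' : C) :
  a * x + b * y <= z -> x = x' -> y = y' -> z = z' -> a * x' + b * y' <= z'.
Proof. by move=> + <- <- <-. Qed.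

Lemma lemx_cvxE n t (X Y Z : 'M[C]_n) : lemx (cvx t X Y) Z <->
  forall v, rC t * qform v X + rC (1 - t) * qform v Y <= qform v Z.
Proof. by split=> H v; move: (H v); rewrite qform_cvx. Qed.

Lemma ando n m (A1 A2 : 'M[C]_n) (V1 V2 : 'M[C]_m) (t r : R) :
  posdef A1 -> posdef A2 -> posdef V1 -> posdef V2 -> 0 <= t <= 1 -> 0 <= r <= 1 ->
  ando_at A1 A2 V1 V2 t r.
Proof.
move=> pA1 pA2 pV1 pV2 t01 r01 v.
have [c1 [a1 [b1 [a10 b10 E1]]]] := qform_tpow v pA1 pV1.
have [c2 [a2 [b2 [a20 b20 E2]]]] := qform_tpow v pA2 pV2.
have [c3 [a3 [b3 [a30 b30 E3]]]] :=
  qform_tpow v (cvx_posdef t01 pA1 pA2) (cvx_posdef t01 pV1 pV2).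
(* The defect of the inequality at exponent [s], tested on [v]; it is continuous in [s]. *)
pose f (s : R) := t * (\sum_k c1 k * (powR (a1 k) s * powR (b1 k) (1 - s)))
  + (1 - t) * (\sum_k c2 k * (powR (a2 k) s * powR (b2 k) (1 - s)))
  - \sum_k c3 k * (powR (a3 k) s * powR (b3 k) (1 - s)).
have fE s := le_rC (qform_cvx_rC t (E1 s) (E2 s)) (E3 s).
apply/fE; rewrite -subr_le0; apply: (@closed_nonpos _ f (ando_at A1 A2 V1 V2 t)).
- apply: cvgB; last exact: continuous_powR_sum.
  by apply: cvgD; apply: cvgMl_tmp; exact: continuous_powR_sum.
- have h0 : ando_at A1 A2 V1 V2 t 0 by exact: ando0.
  have h1 : ando_at A1 A2 V1 V2 t 1 by exact: ando1.
  exact: (bisection h0 h1 (ando_midpoint pA1 pA2 pV1 pV2 t01) r01).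
- by move=> s /(_ v) /fE; rewrite -subr_le0.
Qed.

(** Vectorisation of [J]. It transposes the second tensor factor, which is why Ando's inequality is
    later applied to transposes. *)
Lemma qform_vec n m (J : 'M[C]_(m, n)) (A : 'M[C]_n) (V : 'M[C]_m) :
  qform (\row_k J (mxtens.mxtens_unindex k).2 (mxtens.mxtens_unindex k).1) (A *t V)
  = \tr (J *m A *m J^H *m V^T).
Proof.
set v := \row_k _.
have vE i j : v 0 (mxtens.mxtens_index (i, j)) = J j i by rewrite mxE mxtens.mxtens_indexK.
transitivity (\sum_k \sum_l \sum_i \sum_j J j i * A i k * V j l * (J l k)^*).
  rewrite /qform mxE sum_mxtens; apply: eq_bigr => k _; apply: eq_bigr => l _.
  rewrite adjmxE vE mxE mulr_suml sum_mxtens; apply: eq_bigr => i _; apply: eq_bigr => j _.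
  by rewrite vE mxtens.tensmxE mulrA.
rewrite exchange_big /= /mxtrace.
under [RHS]eq_bigr => j _ do rewrite mxE.
rewrite [RHS]exchange_big /=; apply: eq_bigr => l _.
under [RHS]eq_bigr => j _.
  rewrite mxE mulr_suml.
  under eq_bigr => k _ do rewrite [(J *m A) j k]mxE adjmxE mulr_suml mulr_suml.
  over.
rewrite [RHS]exchange_big /=; apply: eq_bigr => k _.
rewrite exchange_big /=; apply: eq_bigr => j _; apply: eq_bigr => i _.
by rewrite [in RHS]mxE -!mulrA; congr (_ * (_ * _)); rewrite mulrC.
Qed.

Lemma qform_vec_tpow n m (J : 'M[C]_(m, n)) (A : 'M[C]_n) (U : 'M[C]_m) a b : posdef U ->
  qform (\row_k J (mxtens.mxtens_unindex k).2 (mxtens.mxtens_unindex k).1) (tpow A U^T a b)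
  = \tr (J *m mxpow A a *m J^H *m mxpow U b).
Proof. by move=> pU; rewrite /tpow qform_vec (mxpow_tr _ pU) trmxK. Qed.

Lemma lieb n m (J : 'M[C]_(m, n)) (A1 A2 : 'M[C]_n) (U1 U2 : 'M[C]_m) (t r : R) :
  posdef A1 -> posdef A2 -> posdef U1 -> posdef U2 -> 0 <= t <= 1 -> 0 <= r <= 1 ->
  rC t * \tr (J *m mxpow A1 r *m J^H *m mxpow U1 (1 - r)) +
  rC (1 - t) * \tr (J *m mxpow A2 r *m J^H *m mxpow U2 (1 - r)) <=
  \tr (J *m mxpow (cvx t A1 A2) r *m J^H *m mxpow (cvx t U1 U2) (1 - r)).
Proof.
move=> pA1 pA2 pU1 pU2 t01 r01.
have /lemx_cvxE H := ando pA1 pA2 (posdef_tr pU1) (posdef_tr pU2) t01 r01.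
have E := qform_vec_tpow J (cvx t A1 A2) r (1 - r) (cvx_posdef t01 pU1 pU2).
rewrite cvx_tr in E.
exact: (le_lincomb_eq (H _) (qform_vec_tpow J A1 r (1 - r) pU1)
  (qform_vec_tpow J A2 r (1 - r) pU2) E).
Qed.

(** Lieb's inequality in which [J] is the row [v] and [U] is the 1x1 identity. *)
Lemma mxpow_concave n (A1 A2 : 'M[C]_n) (t r : R) :
  posdef A1 -> posdef A2 -> 0 <= t <= 1 -> 0 <= r <= 1 ->
  lemx (cvx t (mxpow A1 r) (mxpow A2 r)) (mxpow (cvx t A1 A2) r).
Proof.
move=> pA1 pA2 t01 r01 v.
have H := lieb v pA1 pA2 (posdef1 R 1) (posdef1 R 1) t01 r01.
have E : cvx t (1%:M : 'M[C]_1) 1%:M = 1%:M.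
  by rewrite /cvx -scalerDl -rCD addrC subrK scale1r.
have trE (X : 'M[C]_n) s : \tr (v *m X *m v^H *m mxpow 1%:M s) = qform v X.
  by rewrite mxpow_id mulmx1 /mxtrace big_ord1.
by rewrite qform_cvx; apply: (le_lincomb_eq H); rewrite ?E; exact: trE.
Qed.

End Lieb.

(** * Positive linear maps and joint convexity of the inverse *)

Section PositiveMaps.
Variable R : realType.
Local Notation C := (R[i]).

Lemma psd_real n (A : 'M[C]_n) v : possemidef A -> exists2 a : R, 0 <= a & qform v A = rC a.
Proof. by move=> /(psd_ge0 v) /rC_ge0. Qed.

(** Adding [e] times the identity to [X] makes strict positivity applicable. A negative value of the
    form of [Psi X] at [v] would be cancelled exactly by one positive [e], a contradiction reached
    without a limit. *)
Lemma strictly_positive_psd n l (Psi : {linear 'M[C]_n -> 'M[C]_l}) :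
  strictly_positive Psi -> forall X, possemidef X -> possemidef (Psi X).
Proof.
move=> sP X pX.
have p1 (e : R) : 0 < e -> posdef (X + rC e *: 1%:M).
  move=> e0; apply/posdefP; split.
    by rewrite /herm adjmxD adjmxZ adjmx1 (psd_herm pX).
  move=> v v0; rewrite qformD qformZ ltr_wpDl ?(psd_ge0 _ pX) //.
  rewrite mulr_gt0 // ?(rC_lt 0) //.
  by case/posdefP: (posdef1 R n) => _; apply.
have P1 := sP _ (posdef1 R n).
have E e : Psi (X + rC e *: 1%:M) = Psi X + rC e *: Psi 1%:M by rewrite linearD linearZ.
have hX : herm (Psi X).
  have := posdef_herm (sP _ (p1 1 ltr01)); rewrite /herm E adjmxD adjmxZ.
  by rewrite (posdef_herm P1) => /addIr.
apply/psdP; split=> // v.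
have [->|v0] := eqVneq v 0; first by rewrite /qform !mul0mx mxE.
rewrite (rC_real (qform_real v hX)) (rC_le 0) leNgt; apply/negP => a0.
case/posdefP: P1 => h1 /(_ v v0) b0.
have {}b0 : 0 < complex.Re (qform v (Psi 1%:M)).
  by move: b0; rewrite {1}(rC_real (qform_real v h1)) (rC_lt 0).
have e0 : 0 < - complex.Re (qform v (Psi X)) / complex.Re (qform v (Psi 1%:M)).
  by rewrite divr_gt0 // oppr_gt0.
case/posdefP: (sP _ (p1 _ e0)) => _ /(_ v v0).
rewrite E qformD qformZ {1}(rC_real (qform_real v hX)).
rewrite {2}(rC_real (qform_real v h1)) -rCM -rCD divfK ?gt_eqF // subrr.
by rewrite (rC_lt 0) ltxx.
Qed.

Lemma invmx_eq n (X Y : 'M[C]_n) : X *m Y = 1%:M -> invmx X = Y.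
Proof.
move=> XY; have [uX _] := mulmx1_unit XY.
by rewrite -[Y]mul1mx -(mulVmx uX) -mulmxA XY mulmx1.
Qed.
Lemma posdef_inv n (A : 'M[C]_n) : posdef A -> posdef (invmx A).
Proof. by move=> pA; rewrite mxpowN1 //; exact: mxpow_posdef. Qed.
Lemma posdef_mulV n (A : 'M[C]_n) : posdef A -> A *m invmx A = 1%:M.
Proof. by move=> /posdef_unit; exact: mulmxV. Qed.
Lemma posdef_Vmul n (A : 'M[C]_n) : posdef A -> invmx A *m A = 1%:M.
Proof. by move=> /posdef_unit; exact: mulVmx. Qed.

Lemma posdef_sqrt n (A : 'M[C]_n) : posdef A -> exists S T : 'M[C]_n,
  [/\ herm S, herm T, S *m T = 1%:M, S *m S = A & T *m T = invmx A].
Proof.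
move=> pA; have pS : posdef (mxsqrt A) by apply: mxfun_posdef => // x; rewrite sqrtr_gt0.
exists (mxsqrt A), (invmx (mxsqrt A)); split.
- exact: posdef_herm.
- exact/posdef_herm/posdef_inv.
- exact: posdef_mulV.
- exact/mxsqrtK/posdef_psd.
- rewrite -[in RHS](mxsqrtK (posdef_psd pA)); symmetry; apply: invmx_eq.
  by rewrite mulmxA -(mulmxA (mxsqrt A)) posdef_mulV // mulmx1 posdef_mulV.
Qed.

(** By [am_gm_form] at [y = x D^-1], twice the form of [D^-1] at [x] is at most the form of [E] at
    [y] plus that of [E^-1] at [x]. Replacing [E] by [D] in the first term gives one copy of the
    left side back. *)
Lemma lemx_inv n (E D : 'M[C]_n) : posdef E -> posdef D -> lemx E D ->
  lemx (invmx D) (invmx E).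
Proof.
move=> pE pD ED x; have [S [T [hS hT ST SS TT]]] := posdef_sqrt pE.
have hD := posdef_herm (posdef_inv pD).
pose y := x *m invmx D.
have := am_gm_form y x hS hT ST; rewrite SS TT.
have -> : bform x 1%:M y = qform x (invmx D).
  by rewrite /bform /qform adjmxM mulmx1 mulmxA hD.
have -> : bform y 1%:M x = qform x (invmx D) by rewrite /bform /qform mulmx1.
have yD : qform y D = qform x (invmx D).
  by rewrite /y -qform_congr hD posdef_Vmul // mul1mx.
move=> H; have := le_trans H (lerD (ED y) (lexx _)).
by rewrite yD lerD2l.
Qed.

Lemma qformE n (v : 'rV[C]_n) A : qform v A = bform v A v.
Proof. by []. Qed.
Lemma bformDl n (x1 x2 y : 'rV[C]_n) A : bform (x1 + x2) A y = bform x1 A y + bform x2 A y.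
Proof. by rewrite /bform !mulmxDl mxE. Qed.
Lemma bformDr n (x y1 y2 : 'rV[C]_n) A : bform x A (y1 + y2) = bform x A y1 + bform x A y2.
Proof. by rewrite /bform adjmxD mulmxDr mxE. Qed.
Lemma bformZl n (x y : 'rV[C]_n) (a : C) A : bform (a *: x) A y = a * bform x A y.
Proof. by rewrite /bform -!scalemxAl mxE. Qed.
Lemma bformZr n (x y : 'rV[C]_n) (a : R) A : bform x A (rC a *: y) = rC a * bform x A y.
Proof. by rewrite /bform adjmxZ -scalemxAr mxE. Qed.
Lemma bform_conj n (x y : 'rV[C]_n) A : herm A -> (bform x A y)^* = bform y A x.
Proof. by move=> hA; rewrite /bform -adjmxE !adjmxM adjmxK hA mulmxA. Qed.

(** The gap between the two sides is a nonnegative multiple of the form of [Q] at [b x1 - a x2]. *)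
Lemma perspective_form n (Q : 'M[C]_n) (x1 x2 : 'rV[C]_n) (t a b : R) :
  possemidef Q -> 0 <= t <= 1 -> 0 < a -> 0 < b ->
  rC (t * a + (1 - t) * b)^-1 * qform (cvx t x1 x2) Q <=
  rC t * (rC a^-1 * qform x1 Q) + rC (1 - t) * (rC b^-1 * qform x2 Q).
Proof.
move=> pQ /andP[t0 t1] a0 b0.
have [q1 _ E1] := psd_real x1 pQ; have [q2 _ E2] := psd_real x2 pQ.
have lin (u v : R) : qform (rC u *: x1 + rC v *: x2) Q =
    rC (u * u) * qform x1 Q + rC (u * v) * (bform x1 Q x2 + bform x2 Q x1)
    + rC (v * v) * qform x2 Q.
  rewrite !qformE !(bformDl, bformDr, bformZl, bformZr) !rCM.
  move: (rC u) (rC v) (bform x1 Q x1) (bform x1 Q x2) (bform x2 Q x1) (bform x2 Q x2).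
  by clear=> u v q11 q12 q21 q22; ring.
have [c Ec] : exists c, bform x1 Q x2 + bform x2 Q x1 = rC c.
  exists (complex.Re (bform x1 Q x2 + bform x2 Q x1)); apply/rC_real/CrealP.
  have -> : (bform x1 Q x2 + bform x2 Q x1)^* = (bform x1 Q x2)^* + (bform x2 Q x1)^*.
    exact: rmorphD.
  by rewrite !(bform_conj _ _ (psd_herm pQ)) addrC.
have := psd_ge0 (rC b *: x1 + rC (- a) *: x2) pQ.
rewrite /cvx !lin E1 E2 Ec -!rCM -!rCD -!rCM !rC_le => H.
have l0 : 0 < t * a + (1 - t) * b by nra.
rewrite -subr_ge0.
have -> : t * (a^-1 * q1) + (1 - t) * (b^-1 * q2) -
   (t * a + (1 - t) * b)^-1 * (t * t * q1 + t * (1 - t) * c + (1 - t) * (1 - t) * q2) =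
   t * (1 - t) / ((t * a + (1 - t) * b) * a * b) *
   (b * b * q1 + b * - a * c + - a * - a * q2).
  by field; rewrite !gt_eqF.
rewrite mulr_ge0 // divr_ge0 ?mulr_ge0 ?subr_ge0 // ltW //.
Qed.

Lemma cvxE m n t (A B : 'M[C]_(m, n)) i j :
  cvx t A B i j = rC t * A i j + rC (1 - t) * B i j.
Proof. by rewrite !mxE. Qed.
Lemma rdiag_cvx n t (a b : 'I_n -> R) :
  rdiag (fun i => t * a i + (1 - t) * b i) = cvx t (rdiag a) (rdiag b).
Proof.
by apply/matrixP => i j; rewrite cvxE !rdiagE [in LHS]rCD !rCM mulrnDl !mulrnAr.
Qed.

Lemma positive_map_lemx n l (Psi : {linear 'M[C]_n -> 'M[C]_l}) (X Y : 'M[C]_n) :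
  (forall X, possemidef X -> possemidef (Psi X)) -> herm X -> herm Y -> lemx X Y ->
  lemx (Psi X) (Psi Y).
Proof.
move=> posPsi hX hY XY v.
have pB : possemidef (Y + rC (-1) *: X).
  apply/psdP; split; first by rewrite /herm adjmxD adjmxZ hX hY.
  move=> w; rewrite qformD qformZ (_ : rC (-1) = -1) ?mulN1r ?subr_ge0 //.
  exact: (rmorphN1 (real_complex R)).
have := psd_ge0 v (posPsi _ pB).
rewrite linearD linearZ qformD qformZ (_ : rC (-1) = -1) ?mulN1r ?subr_ge0 //.
exact: (rmorphN1 (real_complex R)).
Qed.

(** Antitonicity of the inverse reduces [D] to the convex combination; the freedom in [D] serves
    operator concave powers. One congruence [S] then turns [D1] and [D2] into [1] and a diagonal
    [e], the inverses become combinations of fixed positive matrices, and [perspective_form] applies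
    to each. *)
Lemma positive_map_inv_convex n l (Psi : {linear 'M[C]_n -> 'M[C]_l})
    (D1 D2 D : 'M[C]_n) (x1 x2 : 'rV[C]_l) (t : R) :
  (forall X, possemidef X -> possemidef (Psi X)) ->
  0 <= t <= 1 -> posdef D1 -> posdef D2 -> posdef D -> lemx (cvx t D1 D2) D ->
  qform (cvx t x1 x2) (Psi (invmx D)) <=
  rC t * qform x1 (Psi (invmx D1)) + rC (1 - t) * qform x2 (Psi (invmx D2)).
Proof.
move=> posPsi t01 pD1 pD2 pD ED.
have pE := cvx_posdef t01 pD1 pD2.
have /le_trans : qform (cvx t x1 x2) (Psi (invmx D)) <=
    qform (cvx t x1 x2) (Psi (invmx (cvx t D1 D2))).
  exact: (positive_map_lemx posPsi (posdef_herm (posdef_inv pD))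
    (posdef_herm (posdef_inv pE)) (lemx_inv pE pD ED)).
apply; clear D pD ED.
have [L [L' [hL hL' LL' LL _]]] := posdef_sqrt pD1.
have L'L : L' *m L = 1%:M by exact: mulmx1C.
have pM : posdef (L' *m D2 *m L').
  have [uL' _] := mulmx1_unit L'L.
  by have := posdef_congr uL' pD2; rewrite hL'.
have dM := herm_diag (posdef_herm pM).
move: (spectralmx _) (fun i => complex.Re _) dM => P e dM.
have e0 := posdef_eig dM pM.
case: dM => uP uP' EM.
pose S := P *m L; pose Z := L' *m P^H.
have ZS : Z *m S = 1%:M.
  by rewrite /Z /S mulmxA -(mulmxA _ P^H) uP' mulmx1.
have SZ : S *m Z = 1%:M by exact: mulmx1C.
have D1E : D1 = S^H *m rdiag (fun=> 1) *m S.
  by rewrite rdiag1 mulmx1 /S adjmxM hL mulmxA -(mulmxA _ P^H) uP' mulmx1.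
have D2E : D2 = S^H *m rdiag e *m S.
  rewrite /S adjmxM hL !mulmxA -(mulmxA L P^H) -(mulmxA L (P^H *m _)) -EM.
  by rewrite !mulmxA LL' mul1mx -(mulmxA D2) L'L mulmx1.
clearbody S Z.
have inv (l' : 'I_n -> R) (X : 'M[C]_n) : posdef X -> (forall i, 0 < l' i) ->
    X = S^H *m rdiag l' *m S -> invmx X = Z *m rdiag (fun i => (l' i)^-1) *m Z^H.
  move=> pX l0 EX; apply: invmx_eq.
  rewrite EX !mulmxA -(mulmxA _ S Z) SZ mulmx1 -(mulmxA _ (rdiag l')) rdiagM.
  rewrite (@eq_rdiag _ _ _ (fun=> 1)) ?rdiag1 ?mulmx1; last first.
    by move=> i; rewrite divff // gt_eqF.
  by rewrite -adjmxM ZS adjmx1.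
have DE : cvx t D1 D2 = S^H *m rdiag (fun i => t * 1 + (1 - t) * e i) *m S.
  rewrite D1E D2E /cvx.
  rewrite (rdiag_cvx t (fun=> 1) e) /cvx.
  by rewrite mulmxDr mulmxDl -!scalemxAr -!scalemxAl.
have t0 i : 0 < t * 1 + (1 - t) * e i by have := e0 i; case/andP: t01; nra.
(* The image of the rank-one matrix built from column [k] of [Z], common to all three inverses. *)
pose Q k := Psi (Z *m rdiag (fun i => (i == k)%:R) *m Z^H).
have pQ k : possemidef (Q k).
  apply/posPsi/psd_congr; apply: (@eig_psd _ _ 1%:M (fun i => (i == k)%:R)).
    by split; rewrite ?adjmx1 ?mulmx1 ?mul1mx.
  by move=> i; rewrite ler0n.
have PsiE x (l' : 'I_n -> R) : qform x (Psi (Z *m rdiag l' *m Z^H)) =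
    \sum_k rC (l' k) * qform x (Q k).
  have -> : rdiag l' = \sum_k rC (l' k) *: rdiag (fun i => (i == k)%:R).
    apply/matrixP => i j; rewrite rdiagE summxE (bigD1 i) //= big1 => [|k ki].
      by rewrite mxE rdiagE eqxx addr0 mulrnAr (_ : rC true%:R = 1) ?mulr1.
    by rewrite mxE rdiagE eq_sym (negbTE ki) (_ : rC 0 = 0) // mul0rn mulr0.
  rewrite mulmx_sumr mulmx_suml linear_sum /=.
  have qs (F : 'I_n -> 'M[C]_l) : qform x (\sum_k F k) = \sum_k qform x (F k).
    by rewrite /qform mulmx_sumr mulmx_suml summxE.
  rewrite qs; apply: eq_bigr => k _.
  by rewrite -scalemxAr -scalemxAl linearZ qformZ.
rewrite (inv _ _ pE t0 DE) (inv _ _ pD1 _ D1E) // (inv _ _ pD2 e0 D2E) !PsiE.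
rewrite !mulr_sumr -big_split; apply: ler_sum => k _.
exact: perspective_form.
Qed.

End PositiveMaps.

(** * The scalar conjugate function and its equality case *)

Section Conjugate.
Variable R : realType.
Variables (r : R) (G c : R -> R).
Hypothesis r01 : 0 <= r < 1.
Hypothesis c_ge0 : forall u, 0 <= u -> 0 <= c u.
Hypothesis subgrad : forall u v, 0 <= u -> 0 <= v -> G u + c u * (v - u) <= G v.
Hypothesis G0_inf : forall B, (forall u, 0 < u -> B <= G u) -> B <= G 0.
Hypothesis coercive : forall y, 0 <= y -> exists B, forall u, 0 < u ->
  powR u (1 - r) * y - G u <= B.

Lemma weighted_am_gm (w u : R) : 0 <= w -> 0 <= u ->
  powR w r * powR u (1 - r) <= (1 - r) * u + r * w.
Proof.
move=> w0 u0; case/andP: r01 => r0 r1.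
(* Young's inequality is used with exponents [1 / r] and [1 / (1 - r)], so [r = 0] is separate. *)
have [->|rn] := eqVneq r 0.
  by rewrite powRr0 subr0 mul1r mul1r mul0r addr0 powRr1.
have rp : 0 < r by rewrite lt_neqAle eq_sym rn.
have sp : 0 < 1 - r by rewrite subr_gt0.
have := @conjugate_powR R (powR w r) (powR u (1 - r)) r^-1 (1 - r)^-1.
rewrite !powR_ge0 !invr_gt0 => /(_ isT isT rp sp).
rewrite !invrK -!powRrM !divff ?gt_eqF // !powRr1 //.
by move/(_ (subrKC _ _)) => H; lra.
Qed.

(** The Legendre transform of [x -> G (x^(1/(1-r)))] on the positive half-line, in the variable
    [u = x^(1/(1-r))]: a matrix in place of [u] then carries the exponent [1 - r] of Lieb's
    theorem. *)
Definition conjG (y : R) : R :=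
  sup [set z | exists2 u : R, 0 < u & z = powR u (1 - r) * y - G u]%classic.

Lemma conjG_has_sup y : 0 <= y ->
  has_sup [set z | exists2 u : R, 0 < u & z = powR u (1 - r) * y - G u]%classic.
Proof.
move=> /coercive [B HB]; split.
  by exists (powR 1 (1 - r) * y - G 1), 1.
by exists B => z [u u0 ->]; exact: HB.
Qed.

Lemma conjG_ub y u : 0 <= y -> 0 < u -> powR u (1 - r) * y - G u <= conjG y.
Proof.
move=> y0 u0; have /sup_upper_bound := conjG_has_sup y0; apply.
by exists u.
Qed.

Lemma conjG_approx y e : 0 <= y -> 0 < e ->
  exists2 u, 0 < u & conjG y - e <= powR u (1 - r) * y - G u.
Proof.
move=> y0 e0; have [z [u u0 ->] /ltW H] := sup_adherent e0 (conjG_has_sup y0).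
by exists u.
Qed.

Lemma conjG_le y B : (forall u, 0 < u -> powR u (1 - r) * y - G u <= B) -> conjG y <= B.
Proof.
move=> H; apply: ge_sup; first by exists (powR 1 (1 - r) * y - G 1), 1.
by move=> z [u u0 ->]; exact: H.
Qed.

Lemma fenchel x y : 0 <= x -> 0 <= y ->
  x * y <= G (powR x (1 - r)^-1) + conjG y.
Proof.
move=> x0 y0; rewrite -lerBlDl.
have rn : (1 - r)^-1 != 0 by rewrite invr_eq0 subr_eq0 gt_eqF //; case/andP: r01.
have [->|xn] := eqVneq x 0.
  (* The supremum omits [u = 0]; the value there is reached through [G0_inf]. *)
  rewrite powR0 // mul0r sub0r lerNl; apply: G0_inf => u u0.
  rewrite lerNl; apply: le_trans (conjG_ub y0 u0).
  by rewrite lerDr mulr_ge0 // powR_ge0.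
have xp : 0 < x by rewrite lt_neqAle eq_sym xn.
have := conjG_ub y0 (powR_gt0 (1 - r)^-1 xp).
rewrite -powRrM mulVf ?powRr1 //.
by rewrite -invr_eq0.
Qed.

(** The chain-rule derivative of [x -> G (x^(1/(1-r)))], with [c] as derivative of [G] and
    [x^(r/(1-r))] written as a power of [x^(1/(1-r))]. *)
Definition slope (x : R) : R :=
  c (powR x (1 - r)^-1) * ((1 - r)^-1 * powR (powR x (1 - r)^-1) r).

Lemma slope_ge0 x : 0 <= slope x.
Proof.
case/andP: r01 => r0 r1.
rewrite mulr_ge0 ?c_ge0 ?powR_ge0 // mulr_ge0 ?powR_ge0 // invr_ge0 subr_ge0.
exact: ltW.
Qed.

(** Equality case of [fenchel]: weighted AM-GM is the tangent inequality of the concave [u^(1-r)] at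
    [w], and after multiplication by [c w >= 0] the subgradient inequality absorbs it. *)
Lemma conjG_slope x : 0 <= x ->
  conjG (slope x) <= x * slope x - G (powR x (1 - r)^-1).
Proof.
move=> x0; apply: conjG_le => u u0; case/andP: r01 => r0 r1.
have sp : 0 < 1 - r by rewrite subr_gt0.
rewrite /slope; set w := powR x _.
have w0 : 0 <= w by exact: powR_ge0.
have xE : x = powR w (1 - r) by rewrite /w -powRrM mulVf ?gt_eqF // powRr1.
have wE : powR w r * powR w (1 - r) = w.
  by rewrite -powRD ?subrKC ?oner_eq0 // powRr1.
have H1 := weighted_am_gm w0 (ltW u0).
have H2 : (1 - r)^-1 * powR w r * (powR u (1 - r) - x) <= u - w.
  rewrite -mulrA ler_pdivrMl // mulrBr xE wE; lra.
have H3 := ler_wpM2l (c_ge0 w0) H2.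
have H4 := subgrad w0 (ltW u0).
by rewrite -subr_ge0; move: H3 H4; rewrite !mulrA; lra.
Qed.

End Conjugate.

(** * Trace inequalities deduced from Klein's inequality *)

Section TraceFunctions.
Variable R : realType.
Local Notation C := (R[i]).

Definition Retr n (X : 'M[C]_n) : R := complex.Re (\tr X).

Lemma ReD (x y : C) : complex.Re (x + y) = complex.Re x + complex.Re y.
Proof. by case: x y => a b [d e]. Qed.
Lemma ReZ (a : R) (x : C) : complex.Re (rC a * x) = a * complex.Re x.
Proof. by case: x => b d /=; rewrite mul0r subr0. Qed.
Lemma Re_le (x y : C) : x <= y -> complex.Re x <= complex.Re y.
Proof. by rewrite lecE => /andP[]. Qed.
Lemma Retr_cvx n t (X Y : 'M[C]_n) :
  Retr (cvx t X Y) = t * Retr X + (1 - t) * Retr Y.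
Proof. by rewrite /Retr mxtraceD !mxtraceZ ReD !ReZ. Qed.
Lemma RetrC m n (X : 'M[C]_(m, n)) Y : Retr (X *m Y) = Retr (Y *m X).
Proof. by rewrite /Retr mxtrace_mulC. Qed.

Lemma trf_le_psd n (Y : 'M[C]_n) f g : possemidef Y ->
  (forall y, 0 <= y -> f y <= g y) -> trf f Y <= trf g Y.
Proof.
move=> pY fg; have dY := herm_diag (psd_herm pY).
rewrite !(trf_diag _ dY); apply: ler_sum => i _.
exact/fg/(psd_eig dY).
Qed.
Lemma eq_trf_posdef n (Y : 'M[C]_n) f g : posdef Y ->
  (forall y, 0 < y -> f y = g y) -> trf f Y = trf g Y.
Proof. by move=> pY fg; rewrite /trf (eq_mxfun_posdef pY fg). Qed.
Lemma trfB n (A : 'M[C]_n) f g : herm A ->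
  trf (fun x => f x - g x) A = trf f A - trf g A.
Proof. by move=> /herm_diag dA; rewrite !(trf_diag _ dA) sumrB. Qed.
Lemma Retr_mxfunM n (A : 'M[C]_n) f g : herm A ->
  Retr (mxfun f A *m mxfun g A) = trf (fun x => f x * g x) A.
Proof. by move=> hA; rewrite /Retr mxfunM. Qed.

Lemma mxfunN n (A : 'M[C]_n) f : mxfun (fun x => - f x) A = -1 *: mxfun f A.
Proof.
rewrite !mxfun_spectral.
have -> : rdiag (fun i => - f (complex.Re (spectral_diag A 0 i))) =
    -1 *: rdiag (fun i => f (complex.Re (spectral_diag A 0 i))).
  apply/matrixP => i j; rewrite [RHS]mxE !rdiagE mulrnAr; congr (_ *+ _).
  by rewrite mulN1r -(rmorphN (real_complex R)).
by rewrite -scalemxAr -scalemxAl.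
Qed.

Lemma klein_le n (X Y : 'M[C]_n) (S T : R -> Prop) (a b e d : R -> R) P Q x y :
  diagonalizes P x X -> diagonalizes Q y Y ->
  (forall i, S (x i)) -> (forall j, T (y j)) ->
  (forall u v, S u -> T v -> e u * d v <= a u + b v) ->
  Retr (mxfun e X *m mxfun d Y) <= trf a X + trf b Y.
Proof.
move=> dX dY Sx Ty H.
have := @klein _ _ _ _ S T a b (fun u => - e u) d _ _ _ _ dX dY Sx Ty.
rewrite mxfunN -scalemxAl mxtraceZ mulN1r.
have -> : complex.Re (- \tr (mxfun e X *m mxfun d Y)) = - Retr (mxfun e X *m mxfun d Y).
  by rewrite /Retr; case: (\tr _).
by move=> K; rewrite -subr_ge0; apply: K => u v Su Tv; rewrite mulNr subr_ge0 H.
Qed.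

Lemma klein_psd n (X Y : 'M[C]_n) (a b : R -> R) : possemidef X -> possemidef Y ->
  (forall u v, 0 <= u -> 0 <= v -> u * v <= a u + b v) ->
  Retr (X *m Y) <= trf a X + trf b Y.
Proof.
move=> pX pY H; have dX := herm_diag (psd_herm pX); have dY := herm_diag (psd_herm pY).
have := klein_le dX dY (psd_eig dX pX) (psd_eig dY pY) H.
by rewrite !mxfun_id; [| exact: psd_herm | exact: psd_herm].
Qed.

Lemma klein_posdef_psd n (U Y : 'M[C]_n) (a b e : R -> R) : posdef U -> possemidef Y ->
  (forall u v, 0 < u -> 0 <= v -> e u * v <= a u + b v) ->
  Retr (mxfun e U *m Y) <= trf a U + trf b Y.
Proof.
move=> pX pY H; have dX := herm_diag (posdef_herm pX); have dY := herm_diag (psd_herm pY).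
have := klein_le dX dY (posdef_eig dX pX) (psd_eig dY pY) H.
by rewrite (mxfun_id (psd_herm pY)).
Qed.

Lemma klein_posdef n (X U : 'M[C]_n) (a b d : R -> R) : posdef X -> posdef U ->
  (forall u v, 0 < u -> 0 < v -> u * d v <= a u + b v) ->
  Retr (X *m mxfun d U) <= trf a X + trf b U.
Proof.
move=> pX pY H; have dX := herm_diag (posdef_herm pX); have dY := herm_diag (posdef_herm pY).
have := klein_le dX dY (posdef_eig dX pX) (posdef_eig dY pY) H.
by rewrite (mxfun_id (posdef_herm pX)).
Qed.

Lemma cvx_le_trans (t g g1 g2 k k1 k2 : R) : 0 <= t <= 1 ->
  k1 <= g1 + (k - g) -> k2 <= g2 + (k - g) -> k = t * k1 + (1 - t) * k2 ->
  g <= t * g1 + (1 - t) * g2.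
Proof.
move=> /andP[t0 t1] H1 H2 E; have s0 : 0 <= 1 - t by rewrite subr_ge0.
have := ler_wpM2l t0 H1; have := ler_wpM2l s0 H2; lra.
Qed.

(** Klein's inequality lifts the scalar subgradient at [U] to
    [Tr G(X) >= Tr G(U) + Tr c(U) (X - U)]; for [X = U1] and [X = U2] the linear terms average to
    zero. *)
Lemma trf_convex n (G c : R -> R) (U1 U2 : 'M[C]_n) (t : R) :
  (forall u v, 0 <= u -> 0 <= v -> G u + c u * (v - u) <= G v) ->
  0 <= t <= 1 -> posdef U1 -> posdef U2 ->
  trf G (cvx t U1 U2) <= t * trf G U1 + (1 - t) * trf G U2.
Proof.
move=> subgrad t01 pU1 pU2; have pU := cvx_posdef t01 pU1 pU2.
set U := cvx t U1 U2 in pU *; have hU := posdef_herm pU.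
have H (X : 'M[C]_n) : posdef X ->
    Retr (X *m mxfun c U) <= trf G X + trf (fun u => u * c u - G u) U.
  move=> pX; apply: klein_posdef => // u v u0 v0.
  have := subgrad v u (ltW v0) (ltW u0); lra.
have H1 := H _ pU1; have H2 := H _ pU2; rewrite trfB // in H1 H2.
have E : Retr (U *m mxfun c U) = trf (fun u => u * c u) U.
  by rewrite -{1}(mxfun_id hU) Retr_mxfunM.
have E' : Retr (U *m mxfun c U) =
    t * Retr (U1 *m mxfun c U) + (1 - t) * Retr (U2 *m mxfun c U).
  by rewrite -Retr_cvx /cvx {1}/U mulmxDl -!scalemxAl.
exact: (cvx_le_trans t01 H1 H2 (etrans (esym E) E')).
Qed.

Lemma tr_sandwich n (P Q A M W : 'M[C]_n) : P *m Q = A -> Q *m P = A ->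
  Retr (P *m M *m P *m (Q *m W *m Q)) = Retr (A *m M *m A *m W).
Proof.
move=> PQ QP; rewrite !mulmxA RetrC !mulmxA QP.
by rewrite -(mulmxA (A *m M) P Q) PQ.
Qed.

End TraceFunctions.

(** * The variational argument for a coercive [G] *)

Section Core.
Variable R : realType.
Local Notation C := (R[i]).
Variables (r : R) (G c : R -> R).
Hypothesis r01 : 0 <= r < 1.
Hypothesis c_ge0 : forall u, 0 <= u -> 0 <= c u.
Hypothesis subgrad : forall u v, 0 <= u -> 0 <= v -> G u + c u * (v - u) <= G v.
Hypothesis G0_inf : forall B, (forall u, 0 < u -> B <= G u) -> B <= G 0.
Hypothesis coercive : forall y, 0 <= y -> exists B, forall u, 0 < u ->
  powR u (1 - r) * y - G u <= B.

Let F (x : R) := G (powR x (1 - r)^-1).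
Let h := conjG r G.

Lemma psd_congr_herm n (P M : 'M[C]_n) : herm P -> possemidef M -> possemidef (P *m M *m P).
Proof. by move=> hP pM; have := psd_congr P pM; rewrite hP. Qed.

(** Both arguments are Gram matrices of the square matrix [W^(1/2) Q]. The first has the fixed outer
    factor that Lieb's theorem asks for, with only [B] varying. *)
Lemma trf_flip n (Q W B : 'M[C]_n) f : herm Q -> possemidef W -> Q *m Q = B ->
  trf f (mxsqrt W *m B *m (mxsqrt W)^H) = trf f (Q *m W *m Q).
Proof.
move=> hQ pW <-; move: (mxsqrt W) (mxsqrt_herm pW) (mxsqrtK pW) => S hS <-.
have := trf_gram (S *m Q) f; rewrite subrr addr0 adjmxM hS hQ.
by rewrite !mulmxA.
Qed.

(** Fenchel's inequality for an arbitrary [W]. Since [ue] picks near-maximisers in [h], the matrix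
    [U] realises the trace of [h] at [Y] up to [e] per eigenvalue. *)
Lemma core_lower n (A P Q B M W : 'M[C]_n) (ue : R -> R) (e : R) :
  herm P -> herm Q -> P *m Q = A -> Q *m P = A -> Q *m Q = B ->
  possemidef M -> possemidef W ->
  (forall y, 0 <= y -> 0 < ue y) ->
  (forall y, 0 <= y -> h y - e <= powR (ue y) (1 - r) * y - G (ue y)) ->
  let Y := mxsqrt W *m B *m (mxsqrt W)^H in let U := mxfun ue Y in
  posdef U /\
  Retr (A *m M *m A *m W) - (Retr (Y *m mxpow U (1 - r)) - trf G U + e *+ n)
    <= trf F (P *m M *m P).
Proof.
move=> hP hQ PQ QP QQ pM pW ue0 ueP Y U.
have pY : possemidef Y.
  apply: psd_congr; rewrite -QQ -{2}hQ; exact: psd_gram.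
have hY := psd_herm pY.
split; first exact: mxfun_posdef_psd.
have H1 : Retr (P *m M *m P *m (Q *m W *m Q)) <=
    trf F (P *m M *m P) + trf h (Q *m W *m Q).
  apply: klein_psd; [exact: psd_congr_herm | exact: psd_congr_herm |].
  by move=> u v u0 v0; exact: (fenchel r01 G0_inf coercive).
rewrite (tr_sandwich _ _ PQ QP) -(trf_flip h hQ pW QQ) -/Y in H1.
have H2 : trf h Y <= trf (fun y => y * powR (ue y) (1 - r) - G (ue y) + e) Y.
  apply: trf_le_psd => // y y0.
  by rewrite mulrC -lerBlDr; exact: ueP.
rewrite (trfD _ _ hY) (trf_cst _ hY) (trfB _ _ hY) in H2.
have E1 : Retr (Y *m mxpow U (1 - r)) = trf (fun y => y * powR (ue y) (1 - r)) Y.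
  rewrite /mxpow /U (mxfun_comp _ _ hY) -{1}(mxfun_id hY).
  exact: (Retr_mxfunM _ _ hY).
have E2 : trf G U = trf (fun y => G (ue y)) Y by exact: (trf_mxfun _ _ hY).
rewrite E1 E2 lerBlDr; exact: (le_trans H1 (lerD (lexx _) H2)).
Qed.

(** [W] is chosen so that [Q W Q] is the slope at [P M P], the equality case of Fenchel; every [U]
    is admissible because [h] is a supremum. *)
Lemma core_upper n (A P Q Q' B M : 'M[C]_n) :
  herm P -> herm Q -> herm Q' -> Q *m Q' = 1%:M ->
  P *m Q = A -> Q *m P = A -> Q *m Q = B -> possemidef M ->
  exists2 W, possemidef W & forall U, posdef U ->
  trf F (P *m M *m P) <= Retr (A *m M *m A *m W) -
    (Retr (mxsqrt W *m B *m (mxsqrt W)^H *m mxpow U (1 - r)) - trf G U).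
Proof.
move=> hP hQ hQ' QQ' PQ QP QQ pM.
have Q'Q : Q' *m Q = 1%:M by exact: mulmx1C.
have pX : possemidef (P *m M *m P) by exact: psd_congr_herm.
set X := P *m M *m P in pX *; have hX := psd_herm pX.
pose Y := mxfun (slope r c) X.
have pY : possemidef Y by apply: mxfun_psd => // x _; exact: slope_ge0.
exists (Q' *m Y *m Q'); first exact: psd_congr_herm.
set W := Q' *m Y *m Q' => U pU.
have pW : possemidef W by exact: psd_congr_herm.
have WY : Q *m W *m Q = Y.
  by rewrite /W !mulmxA QQ' mul1mx -(mulmxA Y) Q'Q mulmx1.
set Y' := mxsqrt W *m B *m (mxsqrt W)^H.
have pY' : possemidef Y'.
  apply: psd_congr; rewrite -QQ -{2}hQ; exact: psd_gram.
have H1 : Retr (mxpow U (1 - r) *m Y') <= trf G U + trf h Y'.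
  apply: klein_posdef_psd => // u v u0 v0.
  by rewrite -lerBlDl; exact: conjG_ub.
have E1 : trf h Y' = trf (fun x => h (slope r c x)) X.
  rewrite (trf_flip h hQ pW QQ) WY; exact: (trf_mxfun _ _ hX).
have H2 : trf h Y' <= trf (fun x => x * slope r c x - F x) X.
  by rewrite E1; apply: trf_le_psd => // x x0; exact: conjG_slope.
have E2 : Retr (A *m M *m A *m W) = trf (fun x => x * slope r c x) X.
  rewrite -(tr_sandwich _ _ PQ QP) WY -{1}/X -{1}(mxfun_id hX).
  exact: (Retr_mxfunM _ _ hX).
rewrite (trfB _ _ hX) -E2 in H2; rewrite RetrC in H1.
have := le_trans H1 (lerD (lexx _) H2).
by rewrite -lerBlDl lerBrDr -lerBrDl.
Qed.

Lemma Re_cvx_le (t : R) (x y z : C) : rC t * x + rC (1 - t) * y <= z ->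
  t * complex.Re x + (1 - t) * complex.Re y <= complex.Re z.
Proof. by move/Re_le; rewrite ReD !ReZ. Qed.

(** Here [s] stands for the trace of [A M A W], [y] for Lieb's trace and [z] for the trace of
    [G]. *)
Lemma core_combine (t e x x1 x2 s s1 s2 y y1 y2 z z1 z2 : R) : 0 <= t <= 1 ->
  x <= s - (y - z) ->
  s1 - (y1 - z1 + e) <= x1 -> s2 - (y2 - z2 + e) <= x2 ->
  s <= t * s1 + (1 - t) * s2 -> t * y1 + (1 - t) * y2 <= y ->
  z <= t * z1 + (1 - t) * z2 ->
  x <= t * x1 + (1 - t) * x2 + e.
Proof.
move=> /andP[t0 t1] H H1 H2 Hs Hy Hz; have s0 : 0 <= 1 - t by rewrite subr_ge0.
have := ler_wpM2l t0 H1; have := ler_wpM2l s0 H2; lra.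
Qed.

Lemma core_convex n (A1 A2 M1 M2 M : 'M[C]_n) (t ga be : R) :
  ga + be = 1 -> be + be = r ->
  posdef A1 -> posdef A2 -> possemidef M1 -> possemidef M2 -> possemidef M ->
  0 <= t <= 1 ->
  lemx (cvx t A1 A2 *m M *m cvx t A1 A2) (cvx t (A1 *m M1 *m A1) (A2 *m M2 *m A2)) ->
  trf F (mxpow (cvx t A1 A2) ga *m M *m mxpow (cvx t A1 A2) ga) <=
  t * trf F (mxpow A1 ga *m M1 *m mxpow A1 ga) +
  (1 - t) * trf F (mxpow A2 ga *m M2 *m mxpow A2 ga).
Proof.
move=> gb bb pA1 pA2 pM1 pM2 pM t01 HM; have pA := cvx_posdef t01 pA1 pA2.
have PQ (X : 'M[C]_n) : posdef X -> mxpow X ga *m mxpow X be = X.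
  by move=> pX; rewrite (mxpowD pX) gb (mxpow1 pX).
have QP (X : 'M[C]_n) : posdef X -> mxpow X be *m mxpow X ga = X.
  by move=> pX; rewrite (mxpowD pX) [be + ga]addrC gb (mxpow1 pX).
have QQ (X : 'M[C]_n) : posdef X -> mxpow X be *m mxpow X be = mxpow X r.
  by move=> pX; rewrite (mxpowD pX) bb.
have [W pW HW] := core_upper (mxpow_herm pA ga) (mxpow_herm pA be)
  (mxpow_herm pA (- be)) (mxpowVr pA be) (PQ _ pA) (QP _ pA) (QQ _ pA) pM.
apply/ler_addgt0Pr => e' e'0.
have [e e0 en] : exists2 e : R, 0 < e & e *+ n <= e'.
  (* The denominator [n + 1] keeps [e] positive also for [n = 0]. *)
  exists (e' / n.+1%:R); first by rewrite divr_gt0.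
  rewrite -[X in X <= _]mulr_natr -mulrA ger_pMr // mulrC ler_pdivrMr // mul1r ler_nat.
  exact: leqnSn.
(* The near-maximiser must be a single function of [y], because it is applied to matrices by
   functional calculus. *)
have [ue ueP] : exists ue : R -> R, forall y, 0 <= y ->
    0 < ue y /\ h y - e <= powR (ue y) (1 - r) * y - G (ue y).
  have /choice [ue ueP] : forall y, exists u, 0 <= y ->
      0 < u /\ h y - e <= powR u (1 - r) * y - G u.
    move=> y; have [y0|_] := leP 0 y; last by exists 0.
    by have [u u0 H] := conjG_approx coercive y0 e0; exists u.
  by exists ue.
have u1 y : 0 <= y -> 0 < ue y by case/ueP.
have u2 y : 0 <= y -> h y - e <= powR (ue y) (1 - r) * y - G (ue y) by case/ueP.
have [pU1 L1] := core_lower (mxpow_herm pA1 ga) (mxpow_herm pA1 be)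
  (PQ _ pA1) (QP _ pA1) (QQ _ pA1) pM1 pW u1 u2.
have [pU2 L2] := core_lower (mxpow_herm pA2 ga) (mxpow_herm pA2 be)
  (PQ _ pA2) (QP _ pA2) (QQ _ pA2) pM2 pW u1 u2.
(* The upper bound is evaluated at the combination of the two near-maximisers, as joint concavity
   requires. *)
have U := HW _ (cvx_posdef t01 pU1 pU2).
have r01' : 0 <= r <= 1 by case/andP: r01 => -> /ltW.
have HL := Re_cvx_le (lieb (mxsqrt W) pA1 pA2 pU1 pU2 t01 r01').
have HG := trf_convex subgrad t01 pU1 pU2.
have HS := Re_le (tr_lemx pW HM).
have ES : Retr (cvx t (A1 *m M1 *m A1) (A2 *m M2 *m A2) *m W) =
  t * Retr (A1 *m M1 *m A1 *m W) + (1 - t) * Retr (A2 *m M2 *m A2 *m W).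
  by rewrite -Retr_cvx /cvx mulmxDl -!scalemxAl.
have K := core_combine t01 U L1 L2 (eq_ind _ (fun z => _ <= z) HS _ ES) HL HG.
exact: (le_trans K (lerD (lexx _) en)).
Qed.

End Core.

(** * Subgradients of a nondecreasing convex function, up to the endpoint [0] *)

Section Subgradient.
Variable R : realType.
Variable g : R -> R.
Hypothesis g_convex : convex_pos g.
Hypothesis g_nd : nondecreasing_pos g.

Lemma three_slopes v u w : 0 < v -> v < u -> u < w ->
  (g u - g v) / (u - v) <= (g w - g u) / (w - u).
Proof.
move=> v0 vu uw; have vw := lt_trans vu uw.
pose t := (w - u) / (w - v).
have wv0 : 0 < w - v by rewrite subr_gt0.
have t01 : 0 <= t <= 1.
  rewrite divr_ge0 ?subr_ge0 ?(ltW uw) ?(ltW vw) //=.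
  by rewrite ler_pdivrMr // mul1r lerD2l lerN2 ltW.
have := g_convex v0 (lt_trans v0 vw) t01.
have tw : t * (w - v) = w - u by rewrite /t divfK // gt_eqF.
have -> : t * v + (1 - t) * w = u.
  by have -> : t * v + (1 - t) * w = w - t * (w - v); [ring | rewrite tw; ring].
move=> H; rewrite ler_pdivrMr ?subr_gt0 // mulrAC ler_pdivlMr ?subr_gt0 //.
have := ler_wpM2r (ltW wv0) H.
have -> : (t * g v + (1 - t) * g w) * (w - v) =
  t * (w - v) * g v + (w - v - t * (w - v)) * g w by ring.
rewrite tw; nra.
Qed.

(** [c] is the left derivative, as the supremum of the left difference quotients: every right
    quotient bounds them, and monotonicity gives the sign. *)
Lemma subgradient_pos u : 0 < u ->
  exists2 c, 0 <= c & forall v, 0 < v -> g u + c * (v - u) <= g v.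
Proof.
move=> u0; pose S := [set z | exists v, [/\ 0 < v, v < u & z = (g u - g v) / (u - v)]]%classic.
have S0 : S ((g u - g (u / 2)) / (u - u / 2)) by exists (u / 2); split => //; lra.
have Sub w : u < w -> ubound S ((g w - g u) / (w - u)).
  by move=> uw z [v [v0 vu ->]]; exact: three_slopes.
have hS : has_sup S.
  split; first by exists ((g u - g (u / 2)) / (u - u / 2)).
  by exists ((g (u + 1) - g u) / (u + 1 - u)); apply: Sub; lra.
exists (sup S).
  apply: le_trans (sup_upper_bound hS S0).
  by rewrite divr_ge0 // subr_ge0; [apply: g_nd|]; lra.
move=> v v0; have [vu|uv|->] := ltgtP v u; last by rewrite subrr mulr0 addr0.
  have : (g u - g v) / (u - v) <= sup S.
    by apply: (sup_upper_bound hS); exists v.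
  by rewrite ler_pdivrMr ?subr_gt0 //; lra.
have : sup S <= (g v - g u) / (v - u) by apply: ge_sup; [case: hS | exact: Sub].
by rewrite ler_pdivlMr ?subr_gt0 //; lra.
Qed.

(* Singular matrices occur after the reduction by cyclicity, so that a value at
   [0] is needed; the infimum keeps the subgradient inequality. *)
Definition ext0 (u : R) : R :=
  if 0 < u then g u else inf [set z | exists2 v : R, 0 < v & z = g v]%classic.

Lemma ext0_pos u : 0 < u -> ext0 u = g u.
Proof. by rewrite /ext0 => ->. Qed.
Lemma ext00_le u : 0 <= u -> ext0 0 <= ext0 u.
Proof.
rewrite le_eqVlt => /predU1P[<- //|u0]; rewrite (ext0_pos u0) /ext0 ltxx.
have [d d0 Hd] := subgradient_pos ltr01.
apply: ge_inf; last by exists u.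
(* The affine minorant at [1] stays above [g 1 - d] on the half-line, so the infimum is finite. *)
exists (g 1 - d) => z [v v0 ->].
by have := Hd v v0; have := mulr_ge0 d0 (ltW v0); lra.
Qed.
Lemma ext00_ge B : (forall u, 0 < u -> B <= g u) -> B <= ext0 0.
Proof.
move=> H; rewrite /ext0 ltxx; apply: lb_le_inf; first by exists (g 1), 1.
by move=> z [v v0 ->]; exact: H.
Qed.

Lemma ext0_subgradient : exists c : R -> R, (forall u, 0 <= u -> 0 <= c u) /\
  forall u v, 0 <= u -> 0 <= v -> ext0 u + c u * (v - u) <= ext0 v.
Proof.
have /choice [c cP] : forall u, exists c, 0 <= u -> 0 <= c /\
    forall v, 0 <= v -> ext0 u + c * (v - u) <= ext0 v.
  move=> u; have [u0|u0|<-] := ltgtP 0 u; last first.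
  (* At the endpoint [ext0] attains its minimum, so the slope [0] serves. *)
  - exists 0 => _; split=> // v v0; rewrite mul0r addr0; exact: ext00_le.
  - by exists 0.
  have [c c0 Hc] := subgradient_pos u0; exists c => _; split=> // v.
  rewrite (ext0_pos u0) le_eqVlt => /predU1P[<-|v0]; last by rewrite (ext0_pos v0) Hc.
  apply: ext00_ge => w w0; apply: le_trans (Hc w w0).
  by rewrite lerD2l ler_wpM2l // lerD2r ltW.
by exists c; split=> [u /cP [] // | u v /cP [_ H] /H].
Qed.

End Subgradient.

(** Both sides are affine in [e], so [e] may tend to [0]: [K] collects the coefficients of [e], and
    [e = d / (|K| + 1)] contributes at most [d]. *)
Lemma le_perturbed (R : realType) (t a b c a' b' c' : R) :
  (forall e, 0 < e -> a + e * a' <= t * (b + e * b') + (1 - t) * (c + e * c')) ->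
  a <= t * b + (1 - t) * c.
Proof.
move=> H; apply/ler_addgt0Pr => d d0; pose K := t * b' + (1 - t) * c' - a'.
have K0 : 0 < `|K| + 1 by rewrite ltr_wpDl.
have e0 : 0 < d / (`|K| + 1) by rewrite divr_gt0.
have : d / (`|K| + 1) * K <= d.
  rewrite mulrAC ler_pdivrMr // ler_pM2l //.
  by apply: le_trans (ler_norm _) _; rewrite lerDl.
have := H _ e0; rewrite /K; move: (d / _) => e; lra.
Qed.

(** * Extension of [f] to [0] and removal of the quadratic perturbation *)

Section Perturbed.
Variable R : realType.
Local Notation C := (R[i]).
Variables (r : R) (f : R -> R).
Hypothesis r01 : 0 <= r < 1.
Hypothesis f_nd : nondecreasing_pos f.
Hypothesis f_convex : convex_pos (fun x => f (powR x (1 - r))).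

Let g (x : R) := f (powR x (1 - r)).

Lemma comp_powR_nd : nondecreasing_pos g.
Proof.
move=> x y x0 xy; apply: f_nd; first exact: powR_gt0.
have y0 := lt_le_trans x0 xy.
apply: ge0_ler_powR; rewrite ?nnegrE ?(ltW x0) ?(ltW y0) // subr_ge0.
by case/andP: r01 => _ /ltW.
Qed.

(** Passing through [g] gives the value at [0]: the infimum of [f] over the positive half-line. *)
Definition fext (x : R) : R := ext0 g (powR x (1 - r)^-1).

Lemma fext_pos x : 0 < x -> fext x = f x.
Proof.
move=> x0; rewrite /fext ext0_pos ?powR_gt0 // /g -powRrM mulVf ?powRr1 ?(ltW x0) //.
by rewrite subr_eq0 gt_eqF //; case/andP: r01.
Qed.

(* The quadratic term keeps the conjugate function finite. *)
Definition pert (e u : R) : R := ext0 g u + e * (u * u).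

Lemma pert_inf e : 0 < e -> forall B, (forall u, 0 < u -> B <= pert e u) -> B <= pert e 0.
Proof.
move=> e0 B HB; rewrite /pert mulr0 mulr0 addr0; apply: ext00_ge => v v0.
(* The three bounds on [u] give [g u <= g v] and [e u^2 <= e u <= d]. *)
apply/ler_addgt0Pr => d d0; pose u := Num.min v (Num.min 1 (d / e)).
have u0 : 0 < u by rewrite !lt_min v0 ltr01 divr_gt0.
have uv : u <= v by rewrite /u ge_min lexx.
have u1 : u <= 1 by rewrite /u !ge_min lexx orbT.
have ud : u <= d / e by rewrite /u !ge_min lexx !orbT.
apply: le_trans (HB u u0) _; rewrite /pert (ext0_pos _ u0).
apply: lerD; first exact: comp_powR_nd.
move: ud; rewrite ler_pdivlMr // mulrC; apply: le_trans.
by rewrite ler_pM2l // ger_pMr.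
Qed.

Lemma pert_coercive e : 0 < e -> forall y, 0 <= y -> exists B, forall u, 0 < u ->
  powR u (1 - r) * y - pert e u <= B.
Proof.
(* The bound adds up [u^(1-r) <= u + 1], the minimum of [ext0] at [0], and
   [y u <= e u^2 + y^2 / (4 e)], a completed square. *)
move=> e0 y y0; exists (y - ext0 g 0 + y * y / (4 * e)) => u u0.
have H := ext00_le f_convex comp_powR_nd (ltW u0).
have /andP[r0 r1] := r01.
have K : powR u (1 - r) <= u + 1.
  have := weighted_am_gm r01 ler01 (ltW u0); rewrite powR1 mul1r; nra.
have K' := ler_wpM2r y0 K.
have S : 0 <= e * (u * u) - y * u + y * y / (4 * e).
  have -> : e * (u * u) - y * u + y * y / (4 * e) = e * ((u - y / (2 * e)) * (u - y / (2 * e))).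
    by field; rewrite gt_eqF.
  by rewrite mulr_ge0 ?(ltW e0) // -expr2 sqr_ge0.
rewrite /pert; move: H K' S.
move: (ext0 g 0) (ext0 g u) (powR u (1 - r) * y) (y * y / _) => a b k z H K' S; lra.
Qed.

Lemma fext_trace_convex n (A1 A2 M1 M2 M : 'M[C]_n) (t ga be : R) :
  ga + be = 1 -> be + be = r ->
  posdef A1 -> posdef A2 -> possemidef M1 -> possemidef M2 -> possemidef M ->
  0 <= t <= 1 ->
  lemx (cvx t A1 A2 *m M *m cvx t A1 A2) (cvx t (A1 *m M1 *m A1) (A2 *m M2 *m A2)) ->
  trf fext (mxpow (cvx t A1 A2) ga *m M *m mxpow (cvx t A1 A2) ga) <=
  t * trf fext (mxpow A1 ga *m M1 *m mxpow A1 ga) +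
  (1 - t) * trf fext (mxpow A2 ga *m M2 *m mxpow A2 ga).
Proof.
move=> gb bb pA1 pA2 pM1 pM2 pM t01 HM; have pA := cvx_posdef t01 pA1 pA2.
have [c [c0 cP]] := ext0_subgradient f_convex comp_powR_nd.
have hX (A N : 'M[C]_n) : posdef A -> possemidef N -> herm (mxpow A ga *m N *m mxpow A ga).
  by move=> pA' pN; apply/psd_herm/(psd_congr_herm (mxpow_herm pA' ga) pN).
have core e : 0 < e -> forall X X1 X2 : 'M[C]_n,
  X = mxpow (cvx t A1 A2) ga *m M *m mxpow (cvx t A1 A2) ga ->
  X1 = mxpow A1 ga *m M1 *m mxpow A1 ga -> X2 = mxpow A2 ga *m M2 *m mxpow A2 ga ->
  trf (fun x => pert e (powR x (1 - r)^-1)) X <=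
  t * trf (fun x => pert e (powR x (1 - r)^-1)) X1 +
  (1 - t) * trf (fun x => pert e (powR x (1 - r)^-1)) X2.
  move=> e0 X X1 X2 -> -> ->.
  (* The derivative [2 e u] of the quadratic term is added to the subgradient; the slack is
     [e (v - u)^2]. *)
  apply: (@core_convex R r (pert e) (fun u => c u + e * (2 * u)) r01 _ _
    (pert_inf e0) (pert_coercive e0)) gb bb pA1 pA2 pM1 pM2 pM t01 HM => [u u0 | u v u0 v0].
    by rewrite addr_ge0 ?c0 // !mulr_ge0 // ltW.
  rewrite /pert; have := cP u v u0 v0.
  have : 0 <= e * ((v - u) * (v - u)) by rewrite mulr_ge0 ?(ltW e0) // -expr2 sqr_ge0.
  move: (ext0 g u) (ext0 g v) (c u) => a b d; lra.
have {}core e (e0 : 0 < e) := core e e0 _ _ _ erefl erefl erefl.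
move: (hX _ _ pA pM) (hX _ _ pA1 pM1) (hX _ _ pA2 pM2) core.
move: (mxpow (cvx t A1 A2) ga *m M *m mxpow (cvx t A1 A2) ga).
move: (mxpow A1 ga *m M1 *m mxpow A1 ga) (mxpow A2 ga *m M2 *m mxpow A2 ga).
move=> X1 X2 X h h1 h2 core.
pose k (x : R) := powR x (1 - r)^-1 * powR x (1 - r)^-1.
have kE e (Y : 'M[C]_n) : herm Y ->
    trf (fun x => pert e (powR x (1 - r)^-1)) Y = trf fext Y + e * trf k Y.
  by move=> hY; rewrite -trfZ // -trfD.
apply: (@le_perturbed R _ _ _ _ (trf k X) (trf k X1) (trf k X2)) => e e0.
by have := core e e0; rewrite (kE _ _ h) (kE _ _ h1) (kE _ _ h2).
Qed.

End Perturbed.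

(** * The Kraus form of a completely positive map *)

Section Kraus.
Variable R : realType.
Local Notation C := (R[i]).

(** This block matrix is the Choi matrix of the identity map, the Gram matrix of the column that
    stacks the basis vectors. *)
Lemma psd_delta_block n :
  possemidef (\mxblock_(i < n, j < n) (delta_mx i j : 'M[C]_n)).
Proof.
pose T : 'cV[C]_(\sum_(i < n) n) := \mxcol_(i < n) (delta_mx i 0 : 'cV[C]_n).
have TE (i a : 'I_n) k : T (@tagnat.Rank n (fun=> n) i a) k = (a == i)%:R.
  have := mxcolK (fun i : 'I_n => (delta_mx i 0 : 'cV[C]_n)) i.
  by move/matrixP/(_ a k); rewrite -/T mxE => ->; rewrite mxE ord1 eqxx andbT.
suff -> : \mxblock_(i < n, j < n) (delta_mx i j : 'M[C]_n) = T *m T^H.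
  exact: psd_gram.
apply/mxblockP => i j; rewrite mxblockK; apply/matrixP => a b.
rewrite [RHS]mxE mxE mxE big_ord1 adjmxE !TE conjC_nat.
by case: (a == i); case: (b == j); rewrite ?mulr1 ?mulr0.
Qed.

(* [K] is read off the square root of the Choi matrix. *)
Lemma kraus n l (Phi : {linear 'M[C]_n -> 'M[C]_l}) : completely_positive Phi ->
  exists L (K : 'M[C]_(L * n, l)), forall X, Phi X = K^H *m (1%:M *t X) *m K.
Proof.
move=> cP; have pC := cP n _ (psd_delta_block n).
set CM := \mxblock_(i, j) _ in pC.
have hS := mxsqrt_herm pC; have SS := mxsqrtK pC.
move: (mxsqrt CM) hS SS => S hS SS.
pose rk (i : 'I_n) (a : 'I_l) := @tagnat.Rank n (fun=> l) i a.
have PE i j a b : Phi (delta_mx i j) a b = \sum_s (S s (rk i a))^* * S s (rk j b).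
  have := mxblockK (fun i j => Phi (delta_mx i j)) i j; rewrite -/CM -SS.
  move/matrixP/(_ a b) => <-; rewrite mxE mxE; apply: eq_bigr => s _.
  by rewrite -{1}hS adjmxE.
pose K : 'M[C]_((\sum_(i < n) l) * n, l) := \matrix_(k, b)
  S (mxtens.mxtens_unindex k).1 (rk (mxtens.mxtens_unindex k).2 b).
have KE s i b : K (mxtens.mxtens_index (s, i)) b = S s (rk i b).
  by rewrite mxE mxtens.mxtens_indexK.
exists (\sum_(i < n) l)%N, K => X; clearbody K.
apply/matrixP => a b; rewrite {1}[X]matrix_sum_delta linear_sum summxE.
transitivity (\sum_i \sum_j X i j * \sum_s (S s (rk i a))^* * S s (rk j b)).
  apply: eq_bigr => i _; rewrite linear_sum summxE; apply: eq_bigr => j _.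
  by rewrite linearZ mxE PE.
rewrite [RHS]mxE [RHS]sum_mxtens [LHS]exchange_big [RHS]exchange_big.
apply: eq_bigr => j _ /=.
under [RHS]eq_bigr => s _.
  rewrite KE mxE sum_mxtens (bigD1 s) //= [X in _ + X]big1 ?addr0; last first.
    move=> s' s's; apply: big1 => i _.
    by rewrite adjmxE mxtens.tensmxE [1%:M _ _]mxE (negbTE s's) mul0r mulr0.
  under eq_bigr => i _ do rewrite adjmxE KE mxtens.tensmxE [1%:M _ _]mxE eqxx mul1r.
  rewrite mulr_suml.
  over.
rewrite [RHS]exchange_big /=; apply: eq_bigr => i _.
rewrite mulr_sumr; apply: eq_bigr => s _.
by rewrite mulrCA mulrA.
Qed.

End Kraus.

(** * Part (1): reduction by cyclicity *)

Section Reduction.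
Variable R : realType.
Local Notation C := (R[i]).

(** With [T] the square root of [Ps], the matrices [Q T] and [Z K T] have the same Gram matrix
    [T Ph T] on the other side. The constant records the difference in the number of zero
    eigenvalues. *)
Lemma trf_reduce N l (f : R -> R) (Q Ph Ps : 'M[C]_l) (Z : 'M[C]_N) (K : 'M[C]_(N, l)) :
  herm Q -> herm Z -> Q *m Q = Ph -> posdef Ps -> K^H *m (Z *m Z) *m K = Ph ->
  trf f (Q *m Ps *m Q) =
  trf f (Z *m (K *m Ps *m K^H) *m Z) - (f 0 *+ N - f 0 *+ l).
Proof.
move=> hQ hZ QQ pPs KK; have [T [_ [hT _ _ <- _]]] := posdef_sqrt pPs.
have := trf_gram (Q *m T) f; rewrite subrr addr0 adjmxM hQ hT => E1.
have := trf_gram (Z *m K *m T) f; rewrite !adjmxM hZ hT => E2.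
rewrite !mulmxA in E1 E2 *; rewrite E1 E2 addrK.
have -> : T *m Q *m Q *m T = T *m (Q *m Q) *m T by rewrite !mulmxA.
by rewrite QQ -KK !mulmxA.
Qed.

(** Tested on [v], the sandwich is the form of [P] at [v A K], a vector that is linear in [A]. *)
Lemma lemx_sandwich N l (A1 A2 : 'M[C]_N) (K : 'M[C]_(N, l)) (P1 P2 P : 'M[C]_l) (t : R) :
  herm A1 -> herm A2 ->
  (forall x1 x2, qform (cvx t x1 x2) P <= rC t * qform x1 P1 + rC (1 - t) * qform x2 P2) ->
  lemx (cvx t A1 A2 *m (K *m P *m K^H) *m cvx t A1 A2)
    (cvx t (A1 *m (K *m P1 *m K^H) *m A1) (A2 *m (K *m P2 *m K^H) *m A2)).
Proof.
move=> hA1 hA2 H v; rewrite qform_cvx; have hA := herm_cvx t hA1 hA2.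
have E (A : 'M[C]_N) X : herm A ->
    qform v (A *m (K *m X *m K^H) *m A) = qform (v *m A *m K) X.
  by move=> hX; rewrite -!qform_congr hX.
rewrite !E //.
have -> : v *m cvx t A1 A2 *m K = cvx t (v *m A1 *m K) (v *m A2 *m K).
  by rewrite /cvx mulmxDr mulmxDl -!scalemxAr -!scalemxAl.
exact: H.
Qed.

Lemma tens1_cvx L n t (A1 A2 : 'M[C]_n) :
  (1%:M : 'M[C]_L) *t cvx t A1 A2 = cvx t (1%:M *t A1) (1%:M *t A2).
Proof. by rewrite /cvx tensmxDr !tensmxZr. Qed.

Lemma posdef_congr_herm n (Q X : 'M[C]_n) : posdef Q -> posdef X -> posdef (Q *m X *m Q).
Proof. by move=> pQ /(posdef_congr (posdef_unit pQ)); rewrite (posdef_herm pQ). Qed.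

Lemma cvx_shift (t x x1 x2 y y1 y2 k : R) :
  x = y - k -> x1 = y1 - k -> x2 = y2 - k ->
  y <= t * y1 + (1 - t) * y2 -> x <= t * x1 + (1 - t) * x2.
Proof. by move=> -> -> ->; lra. Qed.

Lemma cvx_eq (t x x1 x2 y y1 y2 : R) : x = y -> x1 = y1 -> x2 = y2 ->
  y <= t * y1 + (1 - t) * y2 -> x <= t * x1 + (1 - t) * x2.
Proof. by move=> -> -> ->. Qed.

Variables (n m l : nat).
Variables (Phi : {linear 'M[C]_n -> 'M[C]_l}) (Psi : {linear 'M[C]_m -> 'M[C]_l}).
Variables (f : R -> R) (r q ga be : R).
Hypotheses (sPhi : strictly_positive Phi) (sPsi : strictly_positive Psi).
Hypothesis f_nd : nondecreasing_pos f.
Hypothesis r01 : 0 <= r < 1.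
Hypothesis f_convex : convex_pos (fun x => f (powR x (1 - r))).
Hypotheses (gb : ga + be = 1) (bb : be + be = r).
Hypothesis q01 : -1 <= q <= 0.

Let posPsi := strictly_positive_psd sPsi.

Lemma mxpow_opp_concave (B1 B2 : 'M[C]_m) (t : R) : posdef B1 -> posdef B2 -> 0 <= t <= 1 ->
  lemx (cvx t (mxpow B1 (- q)) (mxpow B2 (- q))) (mxpow (cvx t B1 B2) (- q)).
Proof.
move=> pB1 pB2 t01; apply: mxpow_concave => //.
by case/andP: q01 => q0 q1; rewrite oppr_ge0 q1 lerNl q0.
Qed.

(** [B^q] is the inverse of [B^(-q)], which is operator concave since [-q] lies in [[0, 1]]. *)
Lemma Psi_pow_convex (B1 B2 : 'M[C]_m) (t : R) x1 x2 :
  posdef B1 -> posdef B2 -> 0 <= t <= 1 ->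
  qform (cvx t x1 x2) (Psi (mxpow (cvx t B1 B2) q)) <=
  rC t * qform x1 (Psi (mxpow B1 q)) + rC (1 - t) * qform x2 (Psi (mxpow B2 q)).
Proof.
move=> pB1 pB2 t01; have pB := cvx_posdef t01 pB1 pB2.
have E (B : 'M[C]_m) : posdef B -> invmx (mxpow B (- q)) = mxpow B q.
  by move=> pB'; rewrite (invmx_mxpow pB') opprK.
have := positive_map_inv_convex x1 x2 posPsi t01 (mxpow_posdef pB1 (- q))
  (mxpow_posdef pB2 (- q)) (mxpow_posdef pB (- q)) (mxpow_opp_concave pB1 pB2 t01).
by rewrite (E _ pB) (E _ pB1) (E _ pB2).
Qed.

Lemma jointly_convex_cp (h : R) : h + h = 1 -> completely_positive Phi ->
  jointly_convex (fun (A : 'M[C]_n) (B : 'M[C]_m) =>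
      trf f (mxpow (Phi (mxpow A (ga + ga))) h *m Psi (mxpow B q) *m
             mxpow (Phi (mxpow A (ga + ga))) h)).
Proof.
move=> hh /kraus [L [K KE]] A1 A2 B1 B2 pA1 pA2 pB1 pB2 t t01.
have pA := cvx_posdef t01 pA1 pA2; have pB := cvx_posdef t01 pB1 pB2.
have pT (A : 'M[C]_n) : posdef A -> posdef ((1%:M : 'M[C]_L) *t A).
  by move=> pA'; exact: (tens_posdef (posdef1 R L) pA').
have red (A : 'M[C]_n) (B : 'M[C]_m) : posdef A -> posdef B ->
    trf f (mxpow (Phi (mxpow A (ga + ga))) h *m Psi (mxpow B q) *m
             mxpow (Phi (mxpow A (ga + ga))) h) =
    trf (fext r f) (mxpow (1%:M *t A) ga *m (K *m Psi (mxpow B q) *m K^H)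
       *m mxpow (1%:M *t A) ga) - (fext r f 0 *+ (L * n) - fext r f 0 *+ l).
  move=> pA' pB'.
  have pPh := sPhi (mxpow_posdef pA' (ga + ga)).
  have pPs := sPsi (mxpow_posdef pB' q).
  have pX := posdef_congr_herm (mxpow_posdef pPh h) pPs.
  (* [f] is exchanged for [fext] while the matrix is still positive definite, before cyclicity leads
     to a possibly singular one. *)
  rewrite -(eq_trf_posdef pX (fun x => @fext_pos R r f r01 x)).
  apply: (trf_reduce _ (mxpow_herm pPh h) (mxpow_herm (pT _ pA') ga) _ pPs).
    by rewrite (mxpowD pPh) hh (mxpow1 pPh).
  rewrite (mxpowD (pT _ pA')); congr (_ *m _ *m _).
  exact: (mxfun_ampl _ _ (posdef_herm pA')).
have pM (B : 'M[C]_m) : posdef B -> possemidef (K *m Psi (mxpow B q) *m K^H).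
  by move=> pB'; exact: (psd_congr K (posdef_psd (sPsi (mxpow_posdef pB' q)))).
have redA := red _ _ pA pB; rewrite tens1_cvx in redA.
apply: (cvx_shift redA (red _ _ pA1 pB1) (red _ _ pA2 pB2)).
apply: (fext_trace_convex r01 f_nd f_convex gb bb (pT _ pA1) (pT _ pA2)
  (pM _ pB1) (pM _ pB2) (pM _ pB) t01).
apply: (lemx_sandwich K (posdef_herm (pT _ pA1)) (posdef_herm (pT _ pA2))).
by move=> x1 x2; exact: (Psi_pow_convex x1 x2 pB1 pB2 t01).
Qed.

End Reduction.

(** * Part (2): the inverse, without change of dimension *)

Section InverseReduction.
Variable R : realType.
Local Notation C := (R[i]).
Variables (n m : nat) (Psi : {linear 'M[C]_m -> 'M[C]_n}).
Variables (f : R -> R) (r q ga be : R).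
Hypothesis sPsi : strictly_positive Psi.
Hypothesis f_nd : nondecreasing_pos f.
Hypothesis r01 : 0 <= r < 1.
Hypothesis f_convex : convex_pos (fun x => f (powR x (1 - r))).
Hypotheses (gb : ga + be = 1) (bb : be + be = r).
Hypothesis q01 : -1 <= q <= 0.

Let posPsi := strictly_positive_psd sPsi.

Lemma jointly_convex_inv :
  jointly_convex (fun (A : 'M[C]_n) (B : 'M[C]_m) =>
    trf f (invmx (mxpow A (- ga) *m Psi (mxpow B (- q)) *m mxpow A (- ga)))).
Proof.
move=> A1 A2 B1 B2 pA1 pA2 pB1 pB2 t t01.
have pA := cvx_posdef t01 pA1 pA2; have pB := cvx_posdef t01 pB1 pB2.
have pP (B : 'M[C]_m) : posdef B -> posdef (Psi (mxpow B (- q))).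
  by move=> pB'; exact: (sPsi (mxpow_posdef pB' (- q))).
have red (A : 'M[C]_n) (B : 'M[C]_m) : posdef A -> posdef B ->
    trf f (invmx (mxpow A (- ga) *m Psi (mxpow B (- q)) *m mxpow A (- ga))) =
    trf (fext r f) (mxpow A ga *m (1%:M *m invmx (Psi (mxpow B (- q))) *m 1%:M^H)
      *m mxpow A ga).
  move=> pA' pB'; have pI := posdef_inv (pP _ pB').
  have -> : invmx (mxpow A (- ga) *m Psi (mxpow B (- q)) *m mxpow A (- ga)) =
      mxpow A ga *m invmx (Psi (mxpow B (- q))) *m mxpow A ga.
    apply: invmx_eq; move: (mxpowVl pA' ga) (mxpowVr pA' ga) (posdef_mulV (pP _ pB')).
    move: (mxpow A ga) (mxpow A (- ga)) (Psi _) (invmx _) => S T Y Z TS ST YZ.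
    rewrite !mulmxA -(mulmxA _ T S) TS mulmx1 -(mulmxA T Y Z) YZ mulmx1.
    exact: TS.
  rewrite adjmx1 mul1mx mulmx1; symmetry.
  exact: (eq_trf_posdef (posdef_congr_herm (mxpow_posdef pA' ga) pI)
    (fun x => @fext_pos R r f r01 x)).
have pM (B : 'M[C]_m) : posdef B ->
    possemidef ((1%:M : 'M[C]_n) *m invmx (Psi (mxpow B (- q))) *m 1%:M^H).
  by move=> pB'; exact: (psd_congr 1%:M (posdef_psd (posdef_inv (pP _ pB')))).
apply: (cvx_eq (red _ _ pA pB) (red _ _ pA1 pB1) (red _ _ pA2 pB2)).
apply: (fext_trace_convex r01 f_nd f_convex gb bb pA1 pA2
  (pM _ pB1) (pM _ pB2) (pM _ pB) t01).
apply: (lemx_sandwich 1%:M (posdef_herm pA1) (posdef_herm pA2)) => x1 x2.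
have H : lemx (cvx t (Psi (mxpow B1 (- q))) (Psi (mxpow B2 (- q))))
    (Psi (mxpow (cvx t B1 B2) (- q))).
  have := positive_map_lemx posPsi
    (herm_cvx t (mxpow_herm pB1 (- q)) (mxpow_herm pB2 (- q)))
    (mxpow_herm pB (- q)) (mxpow_opp_concave q01 pB1 pB2 t01).
  by rewrite {1}/cvx linearD !linearZ.
(* The inverse is taken after [Psi], so the positive map is the identity and [D] is the concave
   [Psi (B^(-q))]. *)
exact: (positive_map_inv_convex (Psi := idfun) x1 x2 (fun _ H => H) t01
  (pP _ pB1) (pP _ pB2) (pP _ pB) H).
Qed.

End InverseReduction.

Theorem theorem5p4 (R : realType) (n m l : nat)
  (Phi : {linear 'M[R[i]]_n -> 'M[R[i]]_l})
  (Psi : {linear 'M[R[i]]_m -> 'M[R[i]]_l})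
  (f : R -> R) (p q : R) :
  strictly_positive Phi -> strictly_positive Psi ->
  nondecreasing_pos f ->
  1 < p <= 2 ->
  convex_pos (fun x => f (powR x (p - 1))) ->
  -1 <= q <= 0 ->
  (completely_positive Phi ->
    jointly_convex (fun (A : 'M[R[i]]_n) (B : 'M[R[i]]_m) =>
      trf f (mxpow (Phi (mxpow A p)) (2^-1) *m Psi (mxpow B q) *m
             mxpow (Phi (mxpow A p)) (2^-1))))
  /\
  (forall E : n = l, (forall X, Phi X = castmx (E, E) X) ->
    jointly_convex (fun (A : 'M[R[i]]_n) (B : 'M[R[i]]_m) =>
      trf f (invmx (mxpow (Phi (mxpow A (- p))) (2^-1) *m Psi (mxpow B (- q)) *m
                    mxpow (Phi (mxpow A (- p))) (2^-1))))).
Proof.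
move=> sPhi sPsi f_nd /andP[p1 p2] f_convex q01.
(* The parameters are [r = 2 - p], [ga = p / 2] and [be = 1 - p / 2]; the range of [r] is that of
   [p]. *)
have r01 : 0 <= 2 - p < 1 by lra.
have gb : p / 2 + (1 - p / 2) = 1 by lra.
have bb : 1 - p / 2 + (1 - p / 2) = 2 - p by lra.
have gg : p / 2 + p / 2 = p by lra.
rewrite (_ : p - 1 = 1 - (2 - p)) in f_convex; last by lra.
split=> [cPhi | E PhiE].
  have hh : 2^-1 + 2^-1 = 1 :> R by lra.
  have := jointly_convex_cp sPhi sPsi f_nd r01 f_convex gb bb q01 hh cPhi.
  by rewrite gg.
subst l; move=> A1 A2 B1 B2 pA1 pA2 pB1 pB2 t t01.
have E (A : 'M[R[i]]_n) : posdef A -> mxpow (Phi (mxpow A (- p))) 2^-1 = mxpow A (- (p / 2)).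
  by move=> pA; rewrite PhiE castmx_id (mxpowM pA) mulNr.
have pA := cvx_posdef t01 pA1 pA2.
have := jointly_convex_inv sPsi f_nd r01 f_convex gb bb q01 pA1 pA2 pB1 pB2 t01.
by rewrite -(E _ pA) -(E _ pA1) -(E _ pA2).
Qed.
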